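(* Let $A$ be a dg algebra over $k$ and let $S\subset H(A)$ be an arbitrary set of homogeneous homology classes. Let $X$ be a dg algebra in the derived under category of $A$ whose structure map exhibits $X$ as the localisation of $A$ as a left $A$-module (with respect to $S$). Then $X$ is also the localisation of $A$ at $S$ as a dg algebra, i.e. $X$ is an initial object of the full subcategory of $S$-inverting objects of the derived under category of $A$.
   Context: $k$ is a fixed unital commutative ring. A dg algebra is a unital associative differential $\mathbb{Z}$-graded (homologically graded) $k$-algebra; the category of dg algebras carries the model structure with weak equivalences the quasi-isomorphisms and fibrations the surjections. For a dg algebra $A$ with cofibrant replacement $Q\to A$, the derived under category of $A$ is the homotopy category of the under category $Q\downarrow \mathrm{dgAlg}$ (objects: dg algebras $Y$ with a dg algebra map $Q\to Y$); it is independent of $Q$ up to natural equivalence. An object $Q\to Y$ is $S$-inverting if for each $s\in S\subset H(A)\cong H(Q)$ the image of $s$ in $H(Y)$ is invertible. The localisation of $A$ as a dg algebra is the initial object of the full subcategory of $S$-inverting objects of the derived under category. $A$-modules are dg left $A$-modules, with the model structure whose weak equivalences are quasi-isomorphisms and whose fibrations are surjections; $\mathbb{R}\mathrm{Hom}_A$ is the derived complex of $A$-linear maps. By the paper's standing convention $A$ is first replaced by a cofibrant dg algebra $Q$ whenever necessary (restriction and extension of scalars gives a Quillen equivalence of $A$-modules and $Q$-modules). An $A$-module $N$ is $S$-local if each $s\in S$ acts on $H(N)$ by an isomorphism. A localisation of an $A$-module $M$ is an $S$-local $A$-module $Y$ with a map $f\colon M\to Y$ such that $f^*\colon \mathbb{R}\mathrm{Hom}_A(Y,N)\to\mathbb{R}\mathrm{Hom}_A(M,N)$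 is a quasi-isomorphism for every $S$-local $A$-module $N$. For a dg algebra $X$ in the derived under category, $X$ is regarded as a module with the map $Q\to X$ as the structure map. *)

(* Defs.v *)
From HB Require Import structures.
From mathcomp Require Import all_boot all_order all_algebra.
From mathcomp Require Import boolp classical_sets.
From mathcomp Require Import zify.

Set Implicit Arguments.
Unset Strict Implicit.
Unset Printing Implicit Defensive.

Import GRing.Theory.
Local Open Scope ring_scope.
Local Open Scope quotient_scope.
Local Open Scope classical_set_scope.
Local Obligation Tactic := idtac.
Implicit Types i j l m n r : int.

(* Everything is homologically graded by int.  A graded object is a family of
   k-modules, and every structure map between graded pieces takes as an extra
   argument the equation relating the degrees involved, so that no transport
   along equalities of degrees is needed.  Equality on int is decidable, so
   these equations are proof-irrelevant. *)

Definition ksign (k : pzRingType) (n : int) : k := (-1) ^+ `|n|%N.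
Arguments ksign {k} n.

Section Sign.
Variable k : pzRingType.

Lemma ksignD m n : ksign (m + n) = ksign m * ksign n :> k.
Proof.
rewrite /ksign -exprD -signr_odd -[in RHS]signr_odd; congr (_ ^+ (nat_of_bool _)).
lia.
Qed.

Lemma ksign1 : ksign 1 = -1 :> k.
Proof. by rewrite /ksign expr1. Qed.

Lemma ksignN n : ksign (- n) = ksign n :> k.
Proof. by rewrite /ksign abszN. Qed.

Lemma ksignK n : ksign n * ksign n = 1 :> k.
Proof. by rewrite /ksign -expr2 sqrr_sign. Qed.

End Sign.

Record complex (k : comPzRingType) := Complex {
  cdeg :> int -> lmodType k;
  diff : forall i j : int, i = j + 1 -> cdeg i -> cdeg j;
  diff_linear : forall i j (e : i = j + 1), linear (diff e);
  diff_diff : forall i j l (e : i = j + 1) (e' : j = l + 1) (x : cdeg i),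
    diff e' (diff e x) = 0 }.

Arguments diff {k} c {i j} e x.

HB.instance Definition _ (k : comPzRingType) (C : complex k) i j
    (e : i = j + 1) :=
  GRing.isLinear.Build k (C i) (C j) *:%R (diff C e) (@diff_linear k C i j e).

Record chain_map (k : comPzRingType) (C D : complex k) := ChainMap {
  cmap :> forall n : int, C n -> D n;
  cmap_linear : forall n, linear (@cmap n);
  cmap_diff : forall i j (e : i = j + 1) (x : C i),
    cmap (diff C e x) = diff D e (cmap x) }.

Arguments cmap {k C D} c n x.

HB.instance Definition _ (k : comPzRingType) (C D : complex k)
    (f : chain_map C D) n :=
  GRing.isLinear.Build k (C n) (D n) *:%R (cmap f n) (@cmap_linear k C D f n).

Definition surjective_map (k : comPzRingType) (C D : complex k)
    (f : chain_map C D) : Prop :=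
  forall n (y : D n), exists x : C n, f n x = y.

Section Homology.
Variables (k : comPzRingType) (C : complex k).

Definition is_cycle n (x : C n) : Prop :=
  forall j (e : n = j + 1), diff C e x = 0.

Definition is_boundary n (x : C n) : Prop :=
  exists y : C (n + 1), diff C erefl y = x.

Lemma diff_cycle i j (e : i = j + 1) (x : C i) : is_cycle (diff C e x).
Proof. by move=> l e'; apply: diff_diff. Qed.

Lemma diff_boundary i j (e : i = j + 1) (x : C i) : is_boundary (diff C e x).
Proof. by subst i; exists x. Qed.

Definition cycles n := {x : C n | `[< is_cycle x >]}.

Definition mk_cycle n (x : C n) (hx : is_cycle x) : cycles n :=
  exist _ x (asboolT hx).

Lemma cyclesP n (z : cycles n) : is_cycle (val z).
Proof. exact/asboolP/(valP z). Qed.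

Definition homologous n (x y : cycles n) : bool :=
  `[< is_boundary (val x - val y) >].

Lemma homologous_refl n : reflexive (@homologous n).
Proof. by move=> x; apply/asboolP; exists 0; rewrite linear0 subrr. Qed.

Lemma homologous_sym n : symmetric (@homologous n).
Proof.
suff h x y : @homologous n x y -> homologous y x.
  by move=> x y; apply/idP/idP; exact: h.
by move=> /asboolP[b hb]; apply/asboolP; exists (- b); rewrite linearN /= hb opprB.
Qed.

Lemma homologous_trans n : transitive (@homologous n).
Proof.
move=> y x z /asboolP[b hb] /asboolP[c hc]; apply/asboolP; exists (b + c).
by rewrite linearD /= hb hc addrA subrK.
Qed.

Canonical homologous_equiv n :=
  EquivRel (@homologous n) (@homologous_refl n) (@homologous_sym n)
    (@homologous_trans n).

(* Only the underlying set of H_n(C) is needed. *)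
Definition homology n := {eq_quot @homologous n}.

Definition hclass n (z : cycles n) : homology n := \pi_(homology n) z.

Lemma hclass_eq n (z w : cycles n) :
  hclass z = hclass w <-> is_boundary (val z - val w).
Proof. by split => [/eqquotP/asboolP | h]; last exact/eqquotP/asboolP. Qed.

Lemma hclass_repr n (c : homology n) : hclass (repr c) = c.
Proof. exact: reprK. Qed.

End Homology.

Section HomologyMap.
Variables (k : comPzRingType) (C D : complex k) (f : chain_map C D).

Lemma cmap_cycle n (z : cycles C n) : is_cycle (f n (val z)).
Proof. by move=> j e; rewrite -cmap_diff (cyclesP z) linear0. Qed.

Definition hmap n (c : homology C n) : homology D n :=
  hclass (mk_cycle (cmap_cycle (repr c))).

Lemma hmapE n (z : cycles C n) :
  hmap (hclass z) = hclass (mk_cycle (cmap_cycle z)).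
Proof.
have /hclass_eq[b hb] := hclass_repr (hclass z).
by apply/hclass_eq; exists (f _ b); rewrite -cmap_diff hb linearB.
Qed.

Definition quasi_iso : Prop := forall n, bijective (@hmap n).

End HomologyMap.

Record dgalg (k : comPzRingType) := DGAlg {
  dgalg_complex :> complex k;
  mul : forall i j l : int, i + j = l ->
    dgalg_complex i -> dgalg_complex j -> dgalg_complex l;
  one : dgalg_complex 0;
  mul_linearl : forall i j l (e : i + j = l) y, linear (fun x => mul e x y);
  mul_linearr : forall i j l (e : i + j = l) x, linear (fun y => mul e x y);
  mulA : forall (a b c ab bc abc : int) (e1 : a + b = ab)
    (e2 : ab + c = abc) (e3 : b + c = bc) (e4 : a + bc = abc) x y z,
    mul e2 (mul e1 x y) z = mul e4 x (mul e3 y z);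
  mul1x : forall i (e : 0 + i = i) x, mul e one x = x;
  mulx1 : forall i (e : i + 0 = i) x, mul e x one = x;
  mul_leibniz : forall (i j l i' j' l' : int) (e : i + j = l) (di : i = i' + 1)
    (dj : j = j' + 1) (dl : l = l' + 1) (el : i' + j = l') (er : i + j' = l')
    x y,
    diff dgalg_complex dl (mul e x y) =
      mul el (diff dgalg_complex di x) y
      + ksign i *: mul er x (diff dgalg_complex dj y) }.

Arguments mul {k} d {i j l} e x y.
Arguments one {k} d.

Record dgalg_hom (k : comPzRingType) (A B : dgalg k) := DGAlgHom {
  dgalg_hom_map :> chain_map A B;
  dgalg_hom_mul : forall i j l (e : i + j = l) x y,
    dgalg_hom_map l (mul A e x y) =
      mul B e (dgalg_hom_map i x) (dgalg_hom_map j y);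
  dgalg_hom_one : dgalg_hom_map 0 (one A) = one B }.

(* Left lifting property against surjective quasi-isomorphisms; a map from the
   initial dg algebra k is unique, so it does not appear. *)
Definition cofibrant_dgalg (k : comPzRingType) (Q : dgalg k) : Prop :=
  forall (B C : dgalg k) (p : dgalg_hom B C) (g : dgalg_hom Q C),
    surjective_map p -> quasi_iso p ->
    exists h : dgalg_hom Q B, forall n x, p n (h n x) = g n x.

Definition dgalg_cofibrant_replacement (k : comPzRingType) (Q A : dgalg k)
    (q : dgalg_hom Q A) : Prop :=
  cofibrant_dgalg Q /\ quasi_iso q.

Record dgmod (k : comPzRingType) (A : dgalg k) := DGMod {
  dgmod_complex :> complex k;
  act : forall i j l : int, i + j = l ->
    A i -> dgmod_complex j -> dgmod_complex l;
  act_linearl : forall i j l (e : i + j = l) x, linear (fun a => act e a x);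
  act_linearr : forall i j l (e : i + j = l) a, linear (fun x => act e a x);
  actA : forall (a b c ab bc abc : int) (e1 : a + b = ab)
    (e2 : ab + c = abc) (e3 : b + c = bc) (e4 : a + bc = abc) x y z,
    act e2 (mul A e1 x y) z = act e4 x (act e3 y z);
  act1 : forall i (e : 0 + i = i) x, act e (one A) x = x;
  act_leibniz : forall (i j l i' j' l' : int) (e : i + j = l) (di : i = i' + 1)
    (dj : j = j' + 1) (dl : l = l' + 1) (el : i' + j = l') (er : i + j' = l')
    a x,
    diff dgmod_complex dl (act e a x) =
      act el (diff A di a) x
      + ksign i *: act er a (diff dgmod_complex dj x) }.

Arguments act {k A} d {i j l} e a x.

HB.instance Definition _ (k : comPzRingType) (A : dgalg k) (M : dgmod A) i j l
    (e : i + j = l) (a : A i) :=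
  GRing.isLinear.Build k (M j) (M l) *:%R (act M e a) (@act_linearr k A M i j l e a).

Record dgmod_hom (k : comPzRingType) (A : dgalg k) (M N : dgmod A) :=
  DGModHom {
    dgmod_hom_map :> chain_map M N;
    dgmod_hom_act : forall i j l (e : i + j = l) (a : A i) (x : M j),
      dgmod_hom_map l (act M e a x) = act N e a (dgmod_hom_map j x) }.

Definition cofibrant_dgmod (k : comPzRingType) (A : dgalg k) (P : dgmod A) :
    Prop :=
  forall (M N : dgmod A) (p : dgmod_hom M N) (g : dgmod_hom P N),
    surjective_map p -> quasi_iso p ->
    exists h : dgmod_hom P M, forall n x, p n (h n x) = g n x.

Definition dgmod_cofibrant_replacement (k : comPzRingType) (A : dgalg k)
    (P M : dgmod A) (p : dgmod_hom P M) : Prop :=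
  cofibrant_dgmod P /\ quasi_iso p.

Definition regular (k : comPzRingType) (A : dgalg k) : dgmod A :=
  DGMod (@mul_linearl _ A) (@mul_linearr _ A) (@mulA _ A) (@mul1x _ A)
    (@mul_leibniz _ A).

Section Restriction.
Variables (k : comPzRingType) (A B : dgalg k) (f : dgalg_hom A B).

Definition restr_act i j l (e : i + j = l) (a : A i) (x : B j) : B l :=
  mul B e (f i a) x.

Lemma restr_act_linearl i j l (e : i + j = l) x :
  linear (fun a => restr_act e a x).
Proof. by move=> c a b; rewrite /restr_act linearP mul_linearl. Qed.

Lemma restr_act_linearr i j l (e : i + j = l) a :
  linear (fun x => restr_act e a x).
Proof. exact: mul_linearr. Qed.

Lemma restr_actA (a b c ab bc abc : int) (e1 : a + b = ab)
    (e2 : ab + c = abc) (e3 : b + c = bc) (e4 : a + bc = abc) x y z :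
  restr_act e2 (mul A e1 x y) z = restr_act e4 x (restr_act e3 y z).
Proof. by rewrite /restr_act dgalg_hom_mul; apply: mulA. Qed.

Lemma restr_act1 i (e : 0 + i = i) x : restr_act e (one A) x = x.
Proof. by rewrite /restr_act dgalg_hom_one mul1x. Qed.

Lemma restr_act_leibniz (i j l i' j' l' : int) (e : i + j = l) (di : i = i' + 1)
    (dj : j = j' + 1) (dl : l = l' + 1) (el : i' + j = l') (er : i + j' = l')
    a x :
  diff B dl (restr_act e a x) =
    restr_act el (diff A di a) x + ksign i *: restr_act er a (diff B dj x).
Proof. by rewrite /restr_act (mul_leibniz e di dj dl el er) cmap_diff. Qed.

Definition restriction : dgmod A :=
  DGMod restr_act_linearl restr_act_linearr restr_actA restr_act1
    restr_act_leibniz.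

Definition structure_map : dgmod_hom (regular A) restriction :=
  @DGModHom k A (regular A) restriction f (dgalg_hom_mul f).

End Restriction.

Section HomologyAction.
Variables (k : comPzRingType) (A : dgalg k) (M : dgmod A).

Lemma act_cycle i j l (e : i + j = l) (z : cycles A i) (w : cycles M j) :
  is_cycle (act M e (val z) (val w)).
Proof.
move=> l' dl.
have di : i = (i - 1) + 1 by rewrite subrK.
have dj : j = (j - 1) + 1 by rewrite subrK.
have el : (i - 1) + j = l' by lia.
have er : i + (j - 1) = l' by lia.
rewrite (act_leibniz e di dj dl el er) (cyclesP z) (cyclesP w).
rewrite linear0 scaler0 addr0.
by have := act_linearl (d := M) el (val w) (-1) 0 0; rewrite scaleN1r oppr0 addr0 scaleN1r addNr.
Qed.

Definition hact i j l (e : i + j = l) (a : homology A i) (x : homology M j) :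
    homology M l :=
  hclass (mk_cycle (act_cycle e (repr a) (repr x))).

Lemma hactE i j l (e : i + j = l) (z : cycles A i) (w : cycles M j) :
  hact e (hclass z) (hclass w) = hclass (mk_cycle (act_cycle e z w)).
Proof.
have /hclass_eq[b hb] := hclass_repr (hclass z).
have /hclass_eq[c hc] := hclass_repr (hclass w).
move: hb hc; rewrite /hact.
move: (repr (hclass z)) (repr (hclass w)) => z' w' hb hc; apply/hclass_eq => /=.
have dj : j = (j - 1) + 1 by rewrite subrK.
have di : i = (i - 1) + 1 by rewrite subrK.
have h1 : (i + 1) + j = l + 1 by lia.
have h2 : (i + 1) + (j - 1) = l by lia.
have h3 : i + (j + 1) = l + 1 by lia.
have h4 : (i - 1) + (j + 1) = l by lia.
have aB (m n : int) (f : m + j = n) (u v : A m) (y : M j) :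
    act M f (u - v) y = act M f u y - act M f v y.
  by rewrite -scaleN1r addrC act_linearl scaleN1r addrC.
exists (act M h1 b (val w') + ksign i *: act M h3 (val z) c).
rewrite linearD linearZ /= (act_leibniz h1 erefl dj erefl e h2).
rewrite (act_leibniz h3 di erefl erefl h4 e) hb hc (cyclesP w') (cyclesP z).
have -> : act M h4 0 c = 0.
  by have := act_linearl (d := M) h4 c (-1) 0 0;
    rewrite scaleN1r oppr0 addr0 scaleN1r addNr.
by rewrite linear0 scaler0 addr0 add0r scalerA ksignK scale1r aB linearB addrA subrK.
Qed.

End HomologyAction.

Definition hmul (k : comPzRingType) (A : dgalg k) i j l (e : i + j = l)
    (x : homology A i) (y : homology A j) : homology A l :=
  @hact k A (regular A) i j l e x y.

Lemma one_cycle (k : comPzRingType) (A : dgalg k) : is_cycle (one A).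
Proof.
move=> j e; have e0 : j + 0 = j by rewrite addr0.
have e1 : 0 + j = j by rewrite add0r.
have := mul_leibniz (addr0 0) e e e e0 e1 (one A) (one A).
rewrite !mulx1 mul1x /ksign expr0 scale1r => /eqP.
by rewrite -subr_eq0 opprD addrA subrr sub0r oppr_eq0 => /eqP.
Qed.

Definition hone (k : comPzRingType) (A : dgalg k) : homology A 0 :=
  hclass (mk_cycle (one_cycle A)).

(* Families of A-linear maps M_i -> N_(i + n), A-linear up to the Koszul sign *)
Record ghom (k : comPzRingType) (A : dgalg k) (M N : dgmod A) (n : int) :=
  GHom {
    gfun :> forall i j : int, i + n = j -> M i -> N j;
    gfun_linear : forall i j (e : i + n = j), linear (gfun e);
    gfun_act : forall (m i i' j j' : int) (e : m + i = i') (p : i + n = j)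
      (p' : i' + n = j') (e' : m + j = j') (a : A m) (x : M i),
      gfun p' (act M e a x) = ksign (n * m) *: act N e' a (gfun p x) }.

Arguments gfun {k A M N n} g {i j} e x.

HB.instance Definition _ (k : comPzRingType) (A : dgalg k) (M N : dgmod A) n
    (g : ghom M N n) i j (e : i + n = j) :=
  GRing.isLinear.Build k (M i) (N j) *:%R (gfun g e) (@gfun_linear k A M N n g i j e).

HB.instance Definition _ (k : comPzRingType) (A : dgalg k) (M N : dgmod A) n :=
  gen_eqMixin (ghom M N n).
HB.instance Definition _ (k : comPzRingType) (A : dgalg k) (M N : dgmod A) n :=
  gen_choiceMixin (ghom M N n).

Section GHomModule.
Variables (k : comPzRingType) (A : dgalg k) (M N : dgmod A) (n : int).
Implicit Types g h : ghom M N n.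

Lemma ghom_ext g h :
  (forall i j (e : i + n = j) x, gfun g e x = gfun h e x) -> g = h.
Proof.
case: g h => [g gl ga] [h hl ha] /= gh.
have E : g = h.
  by apply: functional_extensionality_dep => i;
    apply: functional_extensionality_dep => j;
    apply: functional_extensionality_dep => e; apply/funext => x; apply: gh.
by subst h; congr GHom; apply: Prop_irrelevance.
Qed.

Program Definition ghom_zero : ghom M N n := @GHom _ _ _ _ _ (fun _ _ _ _ => 0) _ _.
Next Obligation. by move=> i j e c x y; rewrite scaler0 addr0. Qed.
Next Obligation. by move=> *; rewrite linear0 scaler0. Qed.

Program Definition ghom_opp g : ghom M N n :=
  @GHom _ _ _ _ _ (fun _ _ e x => - gfun g e x) _ _.
Next Obligation. by move=> g i j e c x y; rewrite linearP opprD scalerN. Qed.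
Next Obligation.
by move=> g m i i' j j' e p p' e' a x /=; rewrite (gfun_act g e p p' e') linearN scalerN.
Qed.

Program Definition ghom_add g h : ghom M N n :=
  @GHom _ _ _ _ _ (fun _ _ e x => gfun g e x + gfun h e x) _ _.
Next Obligation.
by move=> g h i j e c x y; rewrite !linearP scalerDr addrACA.
Qed.
Next Obligation.
move=> g h m i i' j j' e p p' e' a x /=.
by rewrite !(gfun_act _ e p p' e') linearD scalerDr.
Qed.

Program Definition ghom_scale (c : k) g : ghom M N n :=
  @GHom _ _ _ _ _ (fun _ _ e x => c *: gfun g e x) _ _.
Next Obligation.
by move=> c g i j e d x y; rewrite linearP scalerDr !scalerA mulrC.
Qed.
Next Obligation.
move=> c g m i i' j j' e p p' e' a x /=.
by rewrite (gfun_act g e p p' e') [act N e' a (_ *: _)]linearZ /= !scalerA mulrC.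
Qed.

Lemma ghom_addA : associative ghom_add.
Proof. by move=> f g h; apply: ghom_ext => * /=; rewrite addrA. Qed.
Lemma ghom_addC : commutative ghom_add.
Proof. by move=> f g; apply: ghom_ext => * /=; rewrite addrC. Qed.
Lemma ghom_add0 : left_id ghom_zero ghom_add.
Proof. by move=> f; apply: ghom_ext => * /=; rewrite add0r. Qed.
Lemma ghom_addN : left_inverse ghom_zero ghom_opp ghom_add.
Proof. by move=> f; apply: ghom_ext => * /=; rewrite addNr. Qed.

HB.instance Definition _ :=
  GRing.isZmodule.Build (ghom M N n) ghom_addA ghom_addC ghom_add0 ghom_addN.

Lemma ghom_scaleA a b g : ghom_scale a (ghom_scale b g) = ghom_scale (a * b) g.
Proof. by apply: ghom_ext => * /=; rewrite scalerA. Qed.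
Lemma ghom_scale1 : left_id 1 ghom_scale.
Proof. by move=> g; apply: ghom_ext => * /=; rewrite scale1r. Qed.
Lemma ghom_scaleDr : right_distributive ghom_scale +%R.
Proof. by move=> a g h; apply: ghom_ext => * /=; rewrite scalerDr. Qed.
Lemma ghom_scaleDl g : {morph ghom_scale^~ g : a b / a + b}.
Proof. by move=> a b; apply: ghom_ext => * /=; rewrite scalerDl. Qed.

HB.instance Definition _ :=
  GRing.Zmodule_isLmodule.Build k (ghom M N n) ghom_scaleA ghom_scale1
    ghom_scaleDr ghom_scaleDl.

End GHomModule.

Section HomComplex.
Variables (k : comPzRingType) (A : dgalg k) (M N : dgmod A).

Lemma hom_deg_succ n m i j : n = m + 1 -> i + m = j -> i + n = j + 1.
Proof. by move=> -> <-; rewrite addrA. Qed.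

Lemma hom_deg_pred n m i j : n = m + 1 -> i + m = j -> i - 1 + n = j.
Proof. by move=> -> <-; rewrite (addrC m) addrA subrK. Qed.

Lemma deg_pred (i : int) : i = i - 1 + 1.
Proof. by rewrite subrK. Qed.

Definition hom_diff_fun n m (e : n = m + 1) (g : ghom M N n) i j
    (p : i + m = j) (x : M i) : N j :=
  diff N erefl (gfun g (hom_deg_succ e p) x)
  - ksign n *: gfun g (hom_deg_pred e p) (diff M (deg_pred i) x).

Lemma hom_diff_funE n m (e : n = m + 1) (g : ghom M N n) (i j i' j' : int)
    (p : i + m = j) (dj : j' = j + 1) (di : i = i' + 1) (p1 : i + n = j')
    (p2 : i' + n = j) (x : M i) :
  hom_diff_fun e g p x = diff N dj (gfun g p1 x) - ksign n *: gfun g p2 (diff M di x).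
Proof.
have E' : i - 1 = i' by lia.
move: di p2; case: i' / E' => di p2.
have E := esym dj; move: dj p1; case: j' / E => dj p1; rewrite /hom_diff_fun.
by rewrite (eq_irrelevance (hom_deg_succ e p) p1) (eq_irrelevance (hom_deg_pred e p) p2)
  (eq_irrelevance (deg_pred i) di) (eq_irrelevance dj erefl).
Qed.

Lemma hom_diff_fun_linear n m (e : n = m + 1) (g : ghom M N n) i j
  (p : i + m = j) : linear (hom_diff_fun e g p).
Proof.
by move=> c x y; rewrite /hom_diff_fun !linearP /= scalerDr addrACA.
Qed.

Lemma hom_diff_fun_act n m (e : n = m + 1) (g : ghom M N n) (r i i' j j' : int)
    (e1 : r + i = i') (p : i + m = j) (p' : i' + m = j') (e2 : r + j = j')
    (a : A r) (x : M i) :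
  hom_diff_fun e g p' (act M e1 a x) =
    ksign (m * r) *: act N e2 a (hom_diff_fun e g p x).
Proof.
have q1 : i + n = j + 1 by lia.
have q2 : i - 1 + n = j by lia.
have q3 : i' + n = j' + 1 by lia.
have q4 : i' - 1 + n = j' by lia.
have r1 : r + (j + 1) = j' + 1 by lia.
have r2 : r - 1 + (j + 1) = j' by lia.
have r3 : r - 1 + i = i' - 1 by lia.
have r4 : r + (i - 1) = i' - 1 by lia.
rewrite (hom_diff_funE e g p' erefl (deg_pred i') q3 q4).
rewrite (hom_diff_funE e g p erefl (deg_pred i) q1 q2).
rewrite (gfun_act g e1 q1 q3 r1) [diff N _ (_ *: _)]linearZ /=.
rewrite (act_leibniz r1 (deg_pred r) erefl erefl r2 e2).
rewrite (act_leibniz e1 (deg_pred r) (deg_pred i) (deg_pred i') r3 r4).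
rewrite [gfun g q4 (_ + _)]linearD /= [gfun g q4 (_ *: _)]linearZ /=.
rewrite (gfun_act g r3 q1 q4 r2) (gfun_act g r4 q2 q4 e2).
rewrite [act N e2 a (_ - _)]linearB /= [act N e2 a (_ *: _)]linearZ /=.
rewrite !scalerDr !scalerN !scalerA.
have s0 : ksign n * ksign (n * (r - 1)) = ksign (n * r) :> k.
  by rewrite mulrBr mulr1 ksignD ksignN mulrC -mulrA ksignK mulr1.
have s1 : ksign (n * r) * ksign r = ksign (m * r) :> k.
  by rewrite e mulrDl mul1r ksignD -mulrA ksignK mulr1.
rewrite s0 s1 opprD addrACA subrr add0r.
by rewrite -mulrA [ksign r * _]mulrC s1 [ksign n * _]mulrC.
Qed.

Definition hom_diff n m (e : n = m + 1) (g : ghom M N n) : ghom M N m :=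
  GHom (hom_diff_fun_linear e g) (hom_diff_fun_act e g).

Lemma hom_diff_linear n m (e : n = m + 1) : linear (hom_diff e).
Proof.
move=> c g h; apply: ghom_ext => i j p x /=.
rewrite /hom_diff_fun /= linearP /= scalerBr !scalerDr.
by rewrite opprD addrACA !scalerA [ksign n * c]mulrC.
Qed.

Lemma hom_diff_diff n m l (e : n = m + 1) (e' : m = l + 1) (g : ghom M N n) :
  hom_diff e' (hom_diff e g) = 0.
Proof.
apply: ghom_ext => i j p x /=.
rewrite {1}/hom_diff_fun /=.
have q1 : i + n = j + 1 + 1 by lia.
have q2 : i - 1 + n = j + 1 by lia.
have q3 : i - 1 - 1 + n = j by lia.
rewrite (hom_diff_funE e g _ erefl (deg_pred i) q1 q2).
rewrite (hom_diff_funE e g _ erefl (deg_pred (i - 1)) q2 q3).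
rewrite linearB linearZ /= !diff_diff linear0 scaler0 subr0 sub0r.
have -> : ksign n = - ksign m :> k by rewrite e ksignD ksign1 mulrN1.
by rewrite scaleNr opprK subrr.
Qed.

Definition hom_complex : complex k :=
  @Complex k (fun n => ghom M N n) hom_diff hom_diff_linear hom_diff_diff.

End HomComplex.

Section Precomposition.
Variables (k : comPzRingType) (A : dgalg k) (M M' : dgmod A).
Variables (f : dgmod_hom M M') (N : dgmod A).

Program Definition precomp_fun n (g : ghom M' N n) : ghom M N n :=
  @GHom _ _ _ _ _ (fun _ _ e x => gfun g e (f _ x)) _ _.
Next Obligation. by move=> n g i j e c x y; rewrite !linearP. Qed.
Next Obligation.
move=> n g m i i' j j' e p p' e' a x /=.
by rewrite dgmod_hom_act (gfun_act g e p p' e').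
Qed.

Lemma precomp_linear n : linear (@precomp_fun n).
Proof. by move=> c g h; apply: ghom_ext. Qed.

Lemma precomp_diff n m (e : n = m + 1) (g : ghom M' N n) :
  precomp_fun (hom_diff e g) = hom_diff e (precomp_fun g).
Proof. by apply: ghom_ext => i j p x /=; rewrite /hom_diff_fun /= cmap_diff. Qed.

Definition precomp : chain_map (hom_complex M' N) (hom_complex M N) :=
  @ChainMap k (hom_complex M' N) (hom_complex M N) precomp_fun precomp_linear
    precomp_diff.

End Precomposition.

Definition homology_classes (k : comPzRingType) (A : dgalg k) :=
  forall n : int, set (homology A n).

Definition S_local (k : comPzRingType) (A : dgalg k) (S : homology_classes A)
    (N : dgmod A) : Prop :=
  forall n (s : homology A n), S n s ->
  forall i j (e : n + i = j), bijective (@hact k A N n i j e s).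

(* All objects are fibrant, so RHom_A(f, N) is Hom_A(ft, N) for a lift ft of f
   to cofibrant replacements P -> M and R -> Y.  Up to quasi-isomorphism this
   does not depend on the replacements or on the lift, so one choice, made for
   all N at once, is asked for. *)
Definition module_localisation (k : comPzRingType) (A : dgalg k)
    (S : homology_classes A) (M Y : dgmod A) (f : dgmod_hom M Y) : Prop :=
  S_local S Y /\
  exists (P R : dgmod A) (p : dgmod_hom P M) (r : dgmod_hom R Y)
      (ft : dgmod_hom P R),
    [/\ dgmod_cofibrant_replacement p, dgmod_cofibrant_replacement r,
        (forall n x, r n (ft n x) = f n (p n x)) &
        forall N : dgmod A, S_local S N -> quasi_iso (precomp ft N)].

Record under (k : comPzRingType) (Q : dgalg k) := Under {
  under_alg :> dgalg k;
  under_str : dgalg_hom Q under_alg }.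

Arguments under_str {k Q} u.

Record under_hom (k : comPzRingType) (Q : dgalg k) (X Y : under Q) :=
  UnderHom {
    under_hom_map :> dgalg_hom X Y;
    under_hom_str : forall n x,
      under_hom_map n (under_str X n x) = under_str Y n x }.

Section UnderCategory.
Variables (k : comPzRingType) (Q : dgalg k).

Program Definition under_id (X : under Q) : under_hom X X :=
  @UnderHom _ _ _ _
    (@DGAlgHom _ _ _ (@ChainMap _ _ _ (fun _ x => x) _ _) _ _) _.
Next Obligation. by []. Qed.
Next Obligation. by []. Qed.
Next Obligation. by []. Qed.
Next Obligation. by []. Qed.
Next Obligation. by []. Qed.

Program Definition under_comp (X Y Z : under Q) (g : under_hom Y Z)
    (f : under_hom X Y) : under_hom X Z :=
  @UnderHom _ _ _ _
    (@DGAlgHom _ _ _ (@ChainMap _ _ _ (fun n x => g n (f n x)) _ _) _ _) _.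
Next Obligation. by move=> X Y Z g f n c x y; rewrite !linearP. Qed.
Next Obligation. by move=> X Y Z g f i j e x /=; rewrite !cmap_diff. Qed.
Next Obligation. by move=> X Y Z g f i j l e x y /=; rewrite !dgalg_hom_mul. Qed.
Next Obligation. by move=> X Y Z g f /=; rewrite !dgalg_hom_one. Qed.
Next Obligation. by move=> X Y Z g f n x /=; rewrite !under_hom_str. Qed.

(* The homotopy category of under Q is its localisation at quasi-isomorphisms:
   the category generated by the maps of under Q and formal inverses of the
   quasi-isomorphisms.  Its morphisms are the expressions ho_hom taken modulo
   the congruence ho_eq. *)
Inductive ho_hom : under Q -> under Q -> Type :=
| ho_map X Y (f : under_hom X Y) : ho_hom X Y
| ho_inv X Y (w : under_hom X Y) (hw : quasi_iso w) : ho_hom Y X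
| ho_comp X Y Z (g : ho_hom Y Z) (f : ho_hom X Y) : ho_hom X Z.

Inductive ho_eq : forall X Y, ho_hom X Y -> ho_hom X Y -> Prop :=
| ho_refl X Y (f : ho_hom X Y) : ho_eq f f
| ho_sym X Y (f g : ho_hom X Y) : ho_eq f g -> ho_eq g f
| ho_trans X Y (f g h : ho_hom X Y) : ho_eq f g -> ho_eq g h -> ho_eq f h
| ho_comp_congr X Y Z (g g' : ho_hom Y Z) (f f' : ho_hom X Y) :
    ho_eq g g' -> ho_eq f f' -> ho_eq (ho_comp g f) (ho_comp g' f')
| ho_compA X Y Z T (h : ho_hom Z T) (g : ho_hom Y Z) (f : ho_hom X Y) :
    ho_eq (ho_comp h (ho_comp g f)) (ho_comp (ho_comp h g) f)
| ho_comp1l X Y (f : ho_hom X Y) : ho_eq (ho_comp (ho_map (under_id Y)) f) f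
| ho_comp1r X Y (f : ho_hom X Y) : ho_eq (ho_comp f (ho_map (under_id X))) f
| ho_map_comp X Y Z (g : under_hom Y Z) (f : under_hom X Y) :
    ho_eq (ho_map (under_comp g f)) (ho_comp (ho_map g) (ho_map f))
| ho_invl X Y (w : under_hom X Y) (hw : quasi_iso w) :
    ho_eq (ho_comp (ho_inv hw) (ho_map w)) (ho_map (under_id X))
| ho_invr X Y (w : under_hom X Y) (hw : quasi_iso w) :
    ho_eq (ho_comp (ho_map w) (ho_inv hw)) (ho_map (under_id Y)).

(* S-inverting: every s in S becomes a unit of H(Y).  As s is homogeneous, so
   is an inverse of it. *)
Definition S_inverting (S : homology_classes Q) (Y : under Q) : Prop :=
  forall n (s : homology Q n), S n s ->
  exists t : homology Y (- n),
    hmul (subrr n) (hmap (under_str Y) s) t = hone Y /\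
    hmul (addNr n) t (hmap (under_str Y) s) = hone Y.

(* Initiality among S-inverting objects: morphisms of the homotopy category are
   classes of ho_eq, so uniqueness is up to ho_eq. *)
Definition dgalg_localisation (S : homology_classes Q) (X : under Q) : Prop :=
  S_inverting S X /\
  forall Y : under Q, S_inverting S Y ->
    exists f : ho_hom X Y, forall g : ho_hom X Y, ho_eq f g.

End UnderCategory.

(* S, as a set of classes in H(Q), under the isomorphism H(Q) -> H(A) *)
Definition classes_along (k : comPzRingType) (Q A : dgalg k)
    (q : dgalg_hom Q A) (S : homology_classes A) : homology_classes Q :=
  fun n => @hmap k Q A q n @^-1` S n.

(* Main.v *)
From HB Require Import structures.
From mathcomp Require Import all_boot all_algebra.
From mathcomp Require Import ssrAC boolp classical_sets zify.
Require Import Defs.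

(** Let [p : P -> Q] and [r : R -> X] be the cofibrant replacements, and let
    [rho] be the image in [R] of a cycle of [P] that [p] sends to [1] up to a
    boundary.  That [Q -> X] is a localisation of modules means that evaluation
    at [rho] is a quasi-isomorphism [Hom_Q(R, N) -> N] for every [S]-local [N]
    (from [evaluation_quasi_iso]): local modules see [R] as the free module on
    [rho].  The proof uses nothing else about [R], apart from [R ~ X].

    Let [E] be the opposite of the dg algebra of [Q]-linear endomorphisms of
    [R].  It acts on [R] from the right, and [e |-> rho e] is a
    quasi-isomorphism [E -> R] because [R] itself is local.  If [Y] inverts
    [S], all modules over [Y] are local over [Q], so [R] becomes free after
    extension of scalars: [y |-> y (x) rho] is a quasi-isomorphism from [Y] to
    the [Y]-[E]-bimodule [Y (x)_Q R] ([tensor_free_quasi_iso]).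

    A bimodule [M] over [A] and [B] with a cycle [m] of degree 0 has a
    triangular dg algebra of triples [(a, b, h)], in which [h] is a homotopy
    between [a m] and [m b].  Its projection to [B] is a quasi-isomorphism when
    [a |-> a m] is one, and its projection to [A] is a quasi-isomorphism when
    [b |-> m b] is one ([tri_projB_quasi_iso], [tri_projA_quasi_iso]).  For
    [M = Y (x)_Q R] and [m = 1 (x) rho] this gives a dg algebra [T_Y] with
    projections [E <- T_Y -> Y], functorial in [Y], of which the first is a
    quasi-isomorphism if [Y] inverts [S]: a morphism [c_Y : E -> Y] of the
    homotopy category.  To have all this under [Q], one uses the triangular
    algebra of the [Q]-[E]-bimodule [R].  Its projection to [Q] is a surjective
    quasi-isomorphism, hence has a section because [Q] is cofibrant, and the
    section is pushed forward to every [T_Y].  As this is the only choice, the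
    family [c_Y] is natural in [Y].

    Finally [c_X] is invertible: [R -> X (x)_Q R] is a quasi-isomorphism, hence
    so is [T_X -> X] ([comparison_tgt_quasi_iso]).  Every morphism [g : X -> Y]
    of the homotopy category is a zigzag of maps under [Q] between objects that
    invert [S], so naturality gives [g c_X = c_Y], that is
    [g = c_Y c_X^-1].  This proves existence and uniqueness at once
    ([cone_leg_initial]). *)

Set Implicit Arguments.
Unset Strict Implicit.
Unset Printing Implicit Defensive.
Import GRing.Theory.
Local Open Scope ring_scope.
Local Open Scope quotient_scope.
Implicit Types i j l m n r : int.

(** * Cycles, boundaries and quasi-isomorphisms *)

Section Boundaries.
Variables (k : comPzRingType) (C : complex k).

Lemma boundaryP n (x : C n) i (e : i = n + 1) :
  is_boundary x <-> exists y, diff C e y = x.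
Proof. by subst i; split. Qed.

Lemma boundary0 n : is_boundary (0 : C n).
Proof. by exists 0; rewrite linear0. Qed.

Lemma boundaryD n (x y : C n) :
  is_boundary x -> is_boundary y -> is_boundary (x + y).
Proof. by move=> [b <-] [c <-]; exists (b + c); rewrite linearD. Qed.

Lemma boundaryZ n c (x : C n) : is_boundary x -> is_boundary (c *: x).
Proof. by move=> [b <-]; exists (c *: b); rewrite linearZ. Qed.

Lemma boundaryN n (x : C n) : is_boundary x -> is_boundary (- x).
Proof. by rewrite -scaleN1r; apply: boundaryZ. Qed.

Lemma boundary_trans n (x y z : C n) :
  is_boundary (x - y) -> is_boundary (y - z) -> is_boundary (x - z).
Proof. by move=> h1 h2; rewrite -(subrK y x) -addrA; apply: boundaryD. Qed.

Lemma boundary_sym n (x y : C n) : is_boundary (x - y) -> is_boundary (y - x).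
Proof. by move=> /boundaryN; rewrite opprB. Qed.

Lemma boundary_homologous n (x y : C n) :
  is_boundary (x - y) -> is_boundary y -> is_boundary x.
Proof. by move=> h1 h2; rewrite -(subrK y x); apply: boundaryD. Qed.

Lemma cycleB n (x y : C n) : is_cycle x -> is_cycle y -> is_cycle (x - y).
Proof. by move=> hx hy j e; rewrite linearB /= hx hy subr0. Qed.

Lemma cycle0 n : is_cycle (0 : C n).
Proof. by move=> j e; rewrite linear0. Qed.

Lemma cycle1P n (x : C n) j (e : n = j + 1) : diff C e x = 0 -> is_cycle x.
Proof.
move=> h j' e'; have E : j = j' by lia.
by subst j'; rewrite (eq_irrelevance e' e).
Qed.

End Boundaries.

Section QuasiIso.
Variables (k : comPzRingType).

Definition hinjective (C D : complex k) (f : chain_map C D) : Prop :=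
  forall n (x : C n), is_cycle x -> is_boundary (f n x) -> is_boundary x.

Definition hsurjective (C D : complex k) (f : chain_map C D) : Prop :=
  forall n (y : D n), is_cycle y ->
  exists2 x : C n, is_cycle x & is_boundary (y - f n x).

Lemma chain_map_cycle (C D : complex k) (f : chain_map C D) n (x : C n) :
  is_cycle x -> is_cycle (f n x).
Proof. by move=> hx j e; rewrite -cmap_diff hx linear0. Qed.

Lemma chain_map_boundary (C D : complex k) (f : chain_map C D) n (x : C n) :
  is_boundary x -> is_boundary (f n x).
Proof. by case=> y <-; rewrite cmap_diff; apply: diff_boundary. Qed.

Lemma injective_surjective_bijective (T U : Type) (f : T -> U) :
  injective f -> (forall y, exists x, f x = y) -> bijective f.
Proof.
move=> fI fS; have [g gK] := choice fS.
by exists g => // x; apply: fI; rewrite gK.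
Qed.

Lemma quasi_isoP (C D : complex k) (f : chain_map C D) :
  quasi_iso f <-> hinjective f /\ hsurjective f.
Proof.
split=> [qf | [fI fS] n].
  split=> n x cx.
    have [g gK _] := qf n => bfx.
    have E : hclass (mk_cycle cx) = hclass (mk_cycle (@cycle0 _ C n)).
      by apply: (can_inj gK); rewrite !hmapE; apply/hclass_eq; rewrite /= linear0 subr0.
    by move/hclass_eq: E; rewrite /= subr0.
  have [g _ gK] := qf n.
  have := gK (hclass (mk_cycle cx)).
  rewrite -{1}(hclass_repr (g (hclass (mk_cycle cx)))) hmapE.
  move: (repr _) => z /hclass_eq /= h; exists (val z); first exact: cyclesP.
  exact: boundary_sym.
apply: injective_surjective_bijective => [x y | y].
  rewrite -(hclass_repr x) -(hclass_repr y) !hmapE.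
  move: (repr x) (repr y) => z w /hclass_eq /= h; apply/hclass_eq.
  apply: (fI); first by apply: cycleB; apply: cyclesP.
  by rewrite linearB.
rewrite -(hclass_repr y); move: (repr y) => z.
have [x cx bx] := fS _ _ (cyclesP z).
exists (hclass (mk_cycle cx)); rewrite hmapE; apply/hclass_eq => /=.
exact: boundary_sym.
Qed.

Section Composition.
Variables (C D F : complex k) (g : chain_map D F) (f : chain_map C D).

Lemma chain_comp_linear n : linear (fun x : C n => g n (f n x)).
Proof. by move=> c x y; rewrite !linearP. Qed.

Lemma chain_comp_diff i j (e : i = j + 1) (x : C i) :
  g j (f j (diff C e x)) = diff F e (g i (f i x)).
Proof. by rewrite !cmap_diff. Qed.

Definition chain_comp : chain_map C F :=
  ChainMap chain_comp_linear chain_comp_diff.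

Lemma quasi_iso_comp : quasi_iso g -> quasi_iso f -> quasi_iso chain_comp.
Proof.
move=> /quasi_isoP[gI gS] /quasi_isoP[fI fS]; apply/quasi_isoP; split=> n x cx.
  by move=> /(gI _ _ (chain_map_cycle _ cx)) /(fI _ _ cx).
have [y cy hy] := gS _ _ cx; have [z cz hz] := fS _ _ cy; exists z => //=.
apply: boundary_trans hy _; rewrite -linearB; exact: chain_map_boundary.
Qed.

Lemma quasi_iso_cancel_left : quasi_iso g -> quasi_iso chain_comp -> quasi_iso f.
Proof.
move=> /quasi_isoP[gI gS] /quasi_isoP[hI hS]; apply/quasi_isoP; split=> n x cx.
  by move=> /(chain_map_boundary g) /(hI _ _ cx).
have [z cz hz] := hS _ _ (chain_map_cycle g cx); exists z => //.
apply: gI; last by rewrite linearB.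
exact/cycleB/chain_map_cycle.
Qed.

Lemma quasi_iso_cancel_right :
  quasi_iso f -> quasi_iso chain_comp -> quasi_iso g.
Proof.
move=> /quasi_isoP[fI fS] /quasi_isoP[hI hS]; apply/quasi_isoP; split=> n x cx.
  move=> bx; have [z cz hz] := fS _ _ cx.
  have bz : is_boundary z.
    apply: hI => //=; apply: boundary_homologous bx.
    by apply: boundary_sym; rewrite -linearB; apply: chain_map_boundary.
  by apply: boundary_homologous hz _; apply: chain_map_boundary.
by have [z cz hz] := hS _ _ cx; exists (f n z) => //; apply: chain_map_cycle.
Qed.

End Composition.

Lemma quasi_iso_homologous (C D : complex k) (f g : chain_map C D) :
  (forall n (x : C n), is_cycle x -> is_boundary (f n x - g n x)) ->
  quasi_iso f -> quasi_iso g.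
Proof.
move=> fg /quasi_isoP[fI fS]; apply/quasi_isoP; split=> n x cx.
  by move=> bx; apply: fI => //; apply: boundary_homologous (fg _ _ cx) bx.
have [z cz hz] := fS _ _ cx; exists z => //.
by apply: boundary_trans hz _; apply: fg.
Qed.

Lemma quasi_iso_id (C : complex k) (f : chain_map C C) :
  (forall n x, f n x = x) -> quasi_iso f.
Proof.
move=> fE; apply/quasi_isoP; split=> n x cx; rewrite ?fE //.
by exists x => //; rewrite fE subrr; apply: boundary0.
Qed.

End QuasiIso.

(** * Graded maps and their composition *)

HB.instance Definition _ (k : comPzRingType) (A : dgalg k) i j l
    (e : i + j = l) (a : A i) :=
  GRing.isLinear.Build k (A j) (A l) *:%R (mul A e a) (@mul_linearr k A i j l e a).

Section Signs.
Variable k : comPzRingType.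

(** Signs of products of degrees are compared through this lemma: [m] and [n]
    have the same parity, with an explicit half difference [r]. *)
Lemma ksign_parity (m n r : int) : m = n + r + r -> ksign m = ksign n :> k.
Proof. by move=> ->; rewrite !ksignD -mulrA ksignK mulr1. Qed.

Lemma ksign0 : ksign 0 = 1 :> k.
Proof. by rewrite /ksign expr0. Qed.

End Signs.

Section GradedHoms.
Variables (k : comPzRingType) (A : dgalg k).

Section GCompDef.
Variables (L M N : dgmod A) (m n l : int) (e : m + n = l).
Variables (f : ghom L M m) (g : ghom M N n).

Lemma gcomp_deg i j : i + l = j -> i + m + n = j.
Proof. by move=> <-; rewrite -e addrA. Qed.

Definition gcomp_fun i j (p : i + l = j) (x : L i) : N j :=
  gfun g (gcomp_deg p) (gfun f erefl x).

Lemma gcomp_funE (i i' j : int) (p : i + l = j) (p1 : i + m = i') (p2 : i' + n = j) x :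
  gcomp_fun p x = gfun g p2 (gfun f p1 x).
Proof. by subst i'; rewrite /gcomp_fun (eq_irrelevance p2 (gcomp_deg p)). Qed.

Lemma gcomp_linear i j (p : i + l = j) : linear (gcomp_fun p).
Proof. by move=> c x y; rewrite /gcomp_fun !linearP. Qed.

Lemma gcomp_act (r i i' j j' : int) (er : r + i = i') (p : i + l = j)
    (p' : i' + l = j') (er' : r + j = j') (a : A r) (x : L i) :
  gcomp_fun p' (act L er a x) = ksign (l * r) *: act N er' a (gcomp_fun p x).
Proof.
have q1 : i' + m = i' + m by [].
have q2 : i' + m + n = j' by lia.
have q3 : r + (i + m) = i' + m by lia.
rewrite (gcomp_funE _ q1 q2) (gfun_act f er erefl q1 q3) linearZ /=.
rewrite (gfun_act g q3 (gcomp_deg p) q2 er') scalerA; congr (_ *: _).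
by rewrite -ksignD -mulrDl e.
Qed.

Definition gcomp : ghom L N l := GHom gcomp_linear gcomp_act.

End GCompDef.

(** The sign depends on the degree of [g] because graded maps act from the left
    while [gcomp] lists them in the order of application. *)
Lemma hom_diff_gcomp (L M N : dgmod A) (m n l m' n' l' : int) (e : m + n = l)
    (dm : m = m' + 1) (dn : n = n' + 1) (dl : l = l' + 1)
    (em : m' + n = l') (en : m + n' = l') (f : ghom L M m) (g : ghom M N n) :
  hom_diff dl (gcomp e f g) =
    gcomp en f (hom_diff dn g) + ksign n *: gcomp em (hom_diff dm f) g.
Proof.
apply: ghom_ext => i j p x /=.
have q1 : i + l = j + 1 by lia.
have q2 : i - 1 + l = j by lia.
have q3 : i + m + n = j + 1 by lia.
have q4 : i - 1 + m + n = j by lia.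
have q6 : i + m = i - 1 + m + 1 by lia.
have q7 : i + m' = i - 1 + m by lia.
rewrite (hom_diff_funE dl (gcomp e f g) p erefl (deg_pred i) q1 q2) /=.
rewrite (gcomp_funE _ _ _ q1 erefl q3) (gcomp_funE _ _ _ q2 erefl q4).
rewrite (gcomp_funE _ _ _ p q7 q4) /=.
rewrite (hom_diff_funE dn g (gcomp_deg en p) erefl q6 q3 q4).
rewrite (hom_diff_funE dm f q7 q6 (deg_pred i) erefl erefl).
rewrite [gfun g q4 (_ - _)]linearB /= [gfun g q4 (_ *: _)]linearZ /=.
rewrite scalerBr scalerA addrA subrK; congr (_ - _ *: _).
by rewrite (_ : ksign l = ksign n * ksign m) // mulrC -ksignD e.
Qed.

Lemma gcompDl (L M N : dgmod A) (m n l : int) (e : m + n = l) (g : ghom M N n) :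
  linear (fun f : ghom L M m => gcomp e f g).
Proof.
by move=> c f f'; apply: ghom_ext => i j p x /=; rewrite /gcomp_fun /= linearP.
Qed.

Lemma gcompDr (L M N : dgmod A) (m n l : int) (e : m + n = l) (f : ghom L M m) :
  linear (fun g : ghom M N n => gcomp e f g).
Proof. by move=> c g g'; apply: ghom_ext => i j p x /=; rewrite /gcomp_fun. Qed.

Lemma gcompA (L M N O : dgmod A) (a b c ab bc abc : int) (e1 : a + b = ab)
    (e2 : ab + c = abc) (e3 : b + c = bc) (e4 : a + bc = abc)
    (f : ghom L M a) (g : ghom M N b) (h : ghom N O c) :
  gcomp e2 (gcomp e1 f g) h = gcomp e4 f (gcomp e3 g h).
Proof.
apply: ghom_ext => i j p x.
have q1 : i + a + b = i + ab by lia.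
have q2 : i + ab + c = j by lia.
have q3 : i + a + bc = j by lia.
rewrite [LHS](gcomp_funE _ _ _ p erefl q2) [RHS](gcomp_funE _ _ _ p erefl q3) /=.
by rewrite (gcomp_funE _ _ _ _ erefl q1) (gcomp_funE _ _ _ _ q1 q2).
Qed.

Section HomAsGHom.
Variables (M N : dgmod A).

Section OfHom.
Variable f : dgmod_hom M N.

Lemma ghom_of_deg i j : i + 0 = j -> 0 + i = j.
Proof. by rewrite addrC. Qed.

(** Multiplication by [one A] carries the value from degree [i] to the degree
    [j], which is equal but not convertible to it. *)
Definition ghom_of_fun i j (e : i + 0 = j) (x : M i) : N j :=
  act N (ghom_of_deg e) (one A) (f i x).

Lemma ghom_of_funE i (e : i + 0 = i) x : ghom_of_fun e x = f i x.
Proof. exact: act1. Qed.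

Lemma ghom_of_linear i j (e : i + 0 = j) : linear (ghom_of_fun e).
Proof. by move=> c x y; rewrite /ghom_of_fun !linearP. Qed.

Lemma ghom_of_act (m i i' j j' : int) (e : m + i = i') (p : i + 0 = j)
    (p' : i' + 0 = j') (e' : m + j = j') (a : A m) (x : M i) :
  ghom_of_fun p' (act M e a x) = ksign (0 * m) *: act N e' a (ghom_of_fun p x).
Proof.
have E : j = i by lia.
have E' : j' = i' by lia.
move: p p' e'; rewrite {}E {}E' => p p' e'.
rewrite !ghom_of_funE mul0r ksign0 scale1r dgmod_hom_act.
by rewrite (eq_irrelevance e e').
Qed.

Definition ghom_of : ghom M N 0 := GHom ghom_of_linear ghom_of_act.

End OfHom.

Section ToHom.
Variables (g : ghom M N 0) (cg : is_cycle (g : hom_complex M N 0)).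

Lemma ghom_cycle0 i j (e : i = j + 1) (x : M i) :
  gfun g (addr0 j) (diff M e x) = diff N e (gfun g (addr0 i) x).
Proof.
have d : 0 = -1 + 1 :> int by [].
have := cg d => /(f_equal (fun h : ghom M N (-1) => gfun h (_ : i - 1 = j) x)).
have q : i - 1 = j by lia.
move=> /(_ q) /=; rewrite (hom_diff_funE d g q e e (addr0 i) (addr0 j)).
by rewrite ksign0 scale1r => /eqP; rewrite subr_eq0 => /eqP.
Qed.

Lemma hom_of_ghom_act i j l (e : i + j = l) (a : A i) (x : M j) :
  gfun g (addr0 l) (act M e a x) = act N e a (gfun g (addr0 j) x).
Proof. by rewrite (gfun_act g e (addr0 j) (addr0 l) e) mul0r ksign0 scale1r. Qed.

Definition hom_of_ghom : dgmod_hom M N :=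
  @DGModHom k A M N
    (@ChainMap k M N (fun n x => gfun g (addr0 n) x)
      (fun n => @gfun_linear k A M N 0 g n n (addr0 n)) (@ghom_cycle0))
    hom_of_ghom_act.
End ToHom.

End HomAsGHom.

End GradedHoms.

(** * Cocones and homotopies of maps out of cofibrant modules *)

Section CoconesAndHomotopies.
Variables (k : comPzRingType) (A : dgalg k).

Lemma pair_ext (T U : Type) (u v : T * U) : u.1 = v.1 -> u.2 = v.2 -> u = v.
Proof. by case: u v => [? ?] [? ?] /= -> ->. Qed.

Section DegreeZero.
Variables (M N : dgmod A) (f : ghom M N 0).

Lemma gfun_act0 (m i i' j j' : int) (e : m + i = i') (p : i + 0 = j)
    (p' : i' + 0 = j') (e' : m + j = j') (a : A m) (x : M i) :
  gfun f p' (act M e a x) = act N e' a (gfun f p x).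
Proof. by rewrite (gfun_act f e p p' e') mul0r ksign0 scale1r. Qed.

Hypothesis cf : is_cycle (f : hom_complex M N 0).

Lemma gfun_diff0 (i i' j j' : int) (e : i = i' + 1) (p : i + 0 = j)
    (p' : i' + 0 = j') (e' : j = j' + 1) (x : M i) :
  gfun f p' (diff M e x) = diff N e' (gfun f p x).
Proof.
have E : j = i by lia.
have E' : j' = i' by lia.
move: p p' e'; rewrite {}E {}E' => p p' e'.
have := ghom_cycle0 cf e x.
rewrite (eq_irrelevance p (addr0 i)) (eq_irrelevance p' (addr0 i')).
by rewrite (eq_irrelevance e' e).
Qed.

End DegreeZero.

(** A graded map has a value in degree [j] for every proof of [i + n = j].
    Maps that are only given in the degrees [i + n], such as components of a
    lift, are extended to these by transport. *)
Section MkGHom.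
Variables (M N : dgmod A) (n : int) (F : forall i, M i -> N (i + n)).
Hypothesis F_linear : forall i, linear (F (i := i)).
Hypothesis F_act : forall (m i i' : int) (e : m + i = i')
  (e' : m + (i + n) = i' + n) (a : A m) (x : M i),
  F (act M e a x) = ksign (n * m) *: act N e' a (F x).

Definition mk_ghom_fun i j (e : i + n = j) (x : M i) : N j :=
  let: erefl := e in F x.

Lemma mk_ghom_linear i j (e : i + n = j) : linear (mk_ghom_fun e).
Proof. by case: j / e => c x y; apply: F_linear. Qed.

Lemma mk_ghom_act (m i i' j j' : int) (e : m + i = i') (p : i + n = j)
    (p' : i' + n = j') (e' : m + j = j') (a : A m) (x : M i) :
  mk_ghom_fun p' (act M e a x) = ksign (n * m) *: act N e' a (mk_ghom_fun p x).
Proof. by move: e'; case: j / p; case: j' / p' => e'; apply: F_act. Qed.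

Definition mk_ghom : ghom M N n := GHom mk_ghom_linear mk_ghom_act.

End MkGHom.

Section Cocone.
Variables (M N : dgmod A) (f : ghom M N 0).
Hypothesis cf : is_cycle (f : hom_complex M N 0).

(** The cocone is shifted so that its projection to [M] is a module map of
    degree 0; the sign in [cocone_act] comes from the shift of [N]. *)
Definition cocone_deg n : lmodType k := (M n * N (n + 1)%R)%type.

Lemma cocone_fdeg i j : i = j + 1 -> i + 0 = j + 1.
Proof. by move=> ->; rewrite addr0. Qed.

Lemma deg_succ i j : i = j + 1 -> i + 1 = j + 1 + 1.
Proof. by move=> ->. Qed.

Definition cocone_diff i j (e : i = j + 1) (v : cocone_deg i) : cocone_deg j :=
  (diff M e v.1, gfun f (cocone_fdeg e) v.1 - diff N (deg_succ e) v.2).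

Lemma cocone_diff_linear i j (e : i = j + 1) : linear (cocone_diff e).
Proof.
move=> c u v; apply: pair_ext; rewrite /cocone_diff !linearP //=.
by rewrite scalerDr addrACA.
Qed.

Lemma cocone_diff_diff i j l (e : i = j + 1) (e' : j = l + 1) v :
  cocone_diff e' (cocone_diff e v) = 0.
Proof.
rewrite /cocone_diff /= diff_diff linearB /= diff_diff subr0.
rewrite (gfun_diff0 cf e (cocone_fdeg e) _ (deg_succ e')) subrr.
by [].
Qed.

Definition cocone_complex : complex k :=
  Complex cocone_diff_linear cocone_diff_diff.

Lemma act_succ i j l : i + j = l -> i + (j + 1) = l + 1.
Proof. by move=> <-; rewrite addrA. Qed.

Definition cocone_act i j l (e : i + j = l) (a : A i) (v : cocone_complex j) :
    cocone_complex l :=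
  (act M e a v.1, ksign i *: act N (act_succ e) a v.2).

Lemma cocone_act_linearl i j l (e : i + j = l) v :
  linear (fun a => cocone_act e a v).
Proof.
move=> c a b; apply: pair_ext; rewrite /cocone_act /= act_linearl //.
by rewrite scalerDr !scalerA mulrC.
Qed.

Lemma cocone_act_linearr i j l (e : i + j = l) a :
  linear (fun v => cocone_act e a v).
Proof.
move=> c u v; apply: pair_ext; rewrite /cocone_act /= !linearP //=.
Qed.

Lemma cocone_actA (a b c ab bc abc : int) (e1 : a + b = ab)
    (e2 : ab + c = abc) (e3 : b + c = bc) (e4 : a + bc = abc) x y z :
  cocone_act e2 (mul A e1 x y) z = cocone_act e4 x (cocone_act e3 y z).
Proof.
rewrite /cocone_act /= (actA e1 e2 e3 e4) linearZ /= scalerA -ksignD e1.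
by rewrite (actA e1 _ (act_succ e3) (act_succ e4)).
Qed.

Lemma cocone_act1 i (e : 0 + i = i) v : cocone_act e (one A) v = v.
Proof. by rewrite /cocone_act act1 act1 ksign0 scale1r; case: v. Qed.

Lemma cocone_act_leibniz (i j l i' j' l' : int) (e : i + j = l) (di : i = i' + 1)
    (dj : j = j' + 1) (dl : l = l' + 1) (el : i' + j = l') (er : i + j' = l')
    a v :
  diff cocone_complex dl (cocone_act e a v) =
    cocone_act el (diff A di a) v
    + ksign i *: cocone_act er a (diff cocone_complex dj v).
Proof.
apply: pair_ext; rewrite /cocone_act /= /cocone_diff /=.
  exact: act_leibniz.
rewrite (gfun_act0 f e (cocone_fdeg dj) _ (act_succ er)) linearZ /=.
rewrite (act_leibniz (act_succ e) di (deg_succ dj) _ (act_succ el) (act_succ er)).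
rewrite scalerDr opprD !scalerA ksignK scale1r linearB /=.
have -> : ksign i = - ksign i' :> k by rewrite di ksignD ksign1 mulrN1.
by rewrite scaleNr opprK scale1r addrCA.
Qed.

Definition cocone : dgmod A :=
  DGMod cocone_act_linearl cocone_act_linearr cocone_actA cocone_act1
    cocone_act_leibniz.

Definition cocone_fst : dgmod_hom cocone M.
Proof.
unshelve refine (@DGModHom k A cocone M (@ChainMap k cocone M
  (fun n (v : cocone n) => v.1) _ _) _); by [].
Defined.

Lemma cocone_fst_surjective : surjective_map cocone_fst.
Proof. by move=> n y; exists (y, 0). Qed.

(** The homology of the cocone measures the failure of [f] to be bijective on
    homology: a cycle [(x, q)] says that [q] bounds [f x], injectivity makes [x]
    a boundary, and surjectivity corrects the primitive of [x] so that its image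
    differs from [q] by a boundary. *)
Lemma cocone_acyclic : quasi_iso (hom_of_ghom cf) ->
  forall n (v : cocone n), is_cycle v -> is_boundary v.
Proof.
move=> /quasi_isoP[fI fS] n [x q] cv.
have e : n = n - 1 + 1 by rewrite subrK.
have [cx cq] : is_cycle x /\ gfun f (cocone_fdeg e) x = diff N (deg_succ e) q.
  have [h1 h2] := cv _ e; split; first exact: (cycle1P h1).
  by apply/eqP; rewrite -subr_eq0 h2.
have bfx : is_boundary (gfun f (addr0 n) x).
  move: (cocone_fdeg e) (deg_succ e) cq; rewrite subrK => p p1 cq.
  by apply/(boundaryP _ p1); exists q; rewrite -cq (eq_irrelevance p (addr0 n)).
have [x1 dx1] := fI _ _ cx bfx.
pose w := gfun f (addr0 (n + 1)) x1 - q.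
have cw : is_cycle w.
  apply: (cycle1P (e := erefl)); rewrite /w linearB /=.
  rewrite -(gfun_diff0 cf erefl (addr0 (n + 1)) (addr0 n)) dx1.
  move: (cocone_fdeg e) (deg_succ e) cq; rewrite subrK => p p1 cq.
  by rewrite (eq_irrelevance (addr0 n) p) cq (eq_irrelevance p1 erefl) subrr.
have [x2 cx2 [z hz]] := fS _ _ cw.
exists (x1 - x2, z); apply: pair_ext => /=.
  by rewrite linearB /= dx1 cx2 subr0.
rewrite (eq_irrelevance (cocone_fdeg _) (addr0 (n + 1))).
rewrite (eq_irrelevance (deg_succ _) erefl) hz /w linearB /=.
by rewrite [_ - q - _]addrAC opprB [LHS]addrC subrK.
Qed.

End Cocone.

Lemma acyclic_quasi_iso (C D : complex k) (f : chain_map C D) :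
  (forall n (x : C n), is_cycle x -> is_boundary x) ->
  (forall n (x : D n), is_cycle x -> is_boundary x) -> quasi_iso f.
Proof.
move=> hC hD; apply/quasi_isoP; split=> n x cx; first by move=> _; apply: hC.
exists 0; first exact: cycle0.
by rewrite linear0 subr0; apply: hD.
Qed.

Section Identity.
Variable M : dgmod A.

Definition dgmod_id : dgmod_hom M M.
Proof.
unshelve refine (@DGModHom k A M M (@ChainMap k M M (fun n x => x) _ _) _); by [].
Defined.

End Identity.

Lemma ghom_of_cycle (M N : dgmod A) (f : dgmod_hom M N) :
  is_cycle (ghom_of f : hom_complex M N 0).
Proof.
move=> n e; apply: ghom_ext => i j p x /=.
have di : i = j + 1 by lia.
rewrite (hom_diff_funE e _ p di di (addr0 i) (addr0 j)) /=.
by rewrite !ghom_of_funE ksign0 scale1r cmap_diff subrr.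
Qed.

Lemma quasi_iso_ext (C D : complex k) (f g : chain_map C D) :
  (forall n x, f n x = g n x) -> quasi_iso f -> quasi_iso g.
Proof.
move=> fg; apply: quasi_iso_homologous => n x _.
by rewrite fg subrr; apply: boundary0.
Qed.

Lemma deg1 : 1 = 0 + 1 :> int.
Proof. by rewrite add0r. Qed.

(** Composition with a quasi-isomorphism [p] is injective on homotopy classes of
    maps out of [P].  Indeed [(g, K)] is a module map to the cocone [V] of [p].
    As [V] is acyclic, the cocone [W] of its identity maps to it by a surjective
    quasi-isomorphism, and a lift of [(g, K)] to [W] is a null-homotopy of
    [(g, K)], the first component of which is [H]. *)
Lemma cofibrant_homotopy_lift (P M N : dgmod A) (p : dgmod_hom M N)
    (g : ghom P M 0) (K : ghom P N 1) :
  cofibrant_dgmod P -> quasi_iso p -> is_cycle (g : hom_complex P M 0) ->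
  (forall i y, p i (gfun g (addr0 i) y) = gfun (hom_diff deg1 K) (addr0 i) y) ->
  exists H : ghom P M 1, g = hom_diff deg1 H.
Proof.
move=> cP qp cg pg.
have qp' : quasi_iso (hom_of_ghom (ghom_of_cycle p)).
  by apply: quasi_iso_ext qp => n x /=; rewrite ghom_of_funE.
pose V := cocone (ghom_of_cycle p).
have aV := cocone_acyclic qp'.
have cI := ghom_of_cycle (dgmod_id V).
pose W := cocone cI.
have aW : forall n (x : W n), is_cycle x -> is_boundary x.
  by apply: cocone_acyclic; apply: quasi_iso_id => n x; apply: ghom_of_funE.
have lG n : linear (fun y : P n => (gfun g (addr0 n) y, gfun K erefl y) : V n).
  by move=> c x y; apply: pair_ext; rewrite /= linearP.
have dG i j (e : i = j + 1) (y : P i) :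
    (gfun g (addr0 j) (diff P e y), gfun K erefl (diff P e y)) =
    diff V e (gfun g (addr0 i) y, gfun K erefl y).
  apply: pair_ext; rewrite /= ?(ghom_cycle0 cg) //.
  subst i; rewrite (eq_irrelevance (cocone_fdeg _) (addr0 (j + 1))) ghom_of_funE pg /=.
  rewrite (hom_diff_funE deg1 K (addr0 (j + 1)) (deg_succ erefl) erefl erefl erefl).
  rewrite ksign1 scaleN1r opprK addrAC.
  by rewrite (eq_irrelevance (deg_succ _) erefl) subrr add0r.
pose G := @ChainMap k P V _ lG dG.
have aG i j l (e : i + j = l) (a : A i) (x : P j) :
    G l (act P e a x) = act V e a (G j x).
  apply: pair_ext; rewrite /= ?(hom_of_ghom_act cg) ?(hom_of_ghom_act g) //.
  by rewrite (gfun_act K e erefl erefl (act_succ e)) mul1r.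
have [h hh] := cP _ _ (cocone_fst cI) (DGModHom aG) (cocone_fst_surjective cI)
  (acyclic_quasi_iso _ aW aV).
pose F i (y : P i) : M (i + 1) := (h i y).2.1.
have F_lin i : linear (F i).
  by move=> c x y; rewrite /F linearP.
have F_act m i i' (e : m + i = i') (e' : m + (i + 1) = i' + 1) (a : A m) (x : P i) :
    F i' (act P e a x) = ksign (1 * m) *: act M e' a (F i x).
  by rewrite /F dgmod_hom_act /= mul1r (eq_irrelevance (act_succ e) e').
exists (mk_ghom F_lin F_act).
apply: ghom_ext => i j e y.
have [i' E] : exists i', i = i' + 1 by exists (i - 1); rewrite subrK.
subst i; have E : j = i' + 1 by lia.
move: e; rewrite {}E => e.
rewrite [RHS](hom_diff_funE deg1 _ e erefl erefl erefl erefl) ksign1.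
rewrite scaleN1r opprK /= /F cmap_diff /=.
have -> : (h (i' + 1) y).1.1 = gfun g e y.
  by have /(congr1 fst) /= := hh _ y; rewrite (eq_irrelevance (addr0 (i' + 1)) e).
rewrite act1.
by rewrite (eq_irrelevance (deg_succ _) erefl) [RHS]addrC subrK.
Qed.

End CoconesAndHomotopies.

(** * Evaluation at a cycle *)

Section Evaluation.
Variables (k : comPzRingType) (A : dgalg k) (P N : dgmod A).

Section EvaluationMap.
Variables (rho : P 0) (crho : is_cycle rho).

Lemma evaluation_linear n :
  linear (fun g : hom_complex P N n => gfun g (add0r n) rho).
Proof. by []. Qed.

Lemma evaluation_diff i j (e : i = j + 1) (g : hom_complex P N i) :
  gfun (diff (hom_complex P N) e g) (add0r j) rho =
  diff N e (gfun g (add0r i) rho).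
Proof.
have e0 : 0 = - 1 + 1 :> int by [].
have q : - 1 + i = j by lia.
rewrite /= (hom_diff_funE e g (add0r j) e e0 (add0r i) q) crho.
by rewrite linear0 scaler0 subr0.
Qed.

Definition evaluation : chain_map (hom_complex P N) N :=
  ChainMap evaluation_linear evaluation_diff.

End EvaluationMap.

Section RightMultiplication.
Variables (p : dgmod_hom P (regular A)) (n : int) (x : N n).

(** The map [y |-> p y x], with the sign that makes it linear in the graded
    sense. *)
Definition right_mul_fun i j (e : i + n = j) (y : P i) : N j :=
  ksign (n * i) *: act N e (p i y) x.

Lemma right_mul_linear i j (e : i + n = j) : linear (right_mul_fun e).
Proof.
move=> c y z; rewrite /right_mul_fun linearP act_linearl scalerDr !scalerA.
by rewrite mulrC.
Qed.

Lemma right_mul_act (m i i' j j' : int) (e : m + i = i') (q : i + n = j)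
    (q' : i' + n = j') (e' : m + j = j') (a : A m) (y : P i) :
  right_mul_fun q' (act P e a y) = ksign (n * m) *: act N e' a (right_mul_fun q y).
Proof.
rewrite /right_mul_fun dgmod_hom_act /= (actA e q' q e') linearZ /= scalerA.
by rewrite -ksignD -mulrDr e.
Qed.

Definition right_mul : ghom P N n := GHom right_mul_linear right_mul_act.

End RightMultiplication.

Lemma hom_diff_right_mul (p : dgmod_hom P (regular A)) n m (e : n = m + 1)
    (x : N n) : hom_diff e (right_mul p x) = right_mul p (diff N e x).
Proof.
apply: ghom_ext => i j q y.
have q1 : i + n = j + 1 by lia.
have q2 : i - 1 + n = j by lia.
rewrite [LHS](hom_diff_funE e (right_mul p x) q erefl (deg_pred i) q1 q2) /=.
rewrite /right_mul_fun linearZ /=.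
rewrite (act_leibniz q1 (deg_pred i) e erefl q2 q) -cmap_diff /=.
rewrite scalerDr !scalerA -!ksignD.
have -> : ksign (n + n * (i - 1)) = ksign (n * i) :> k.
  by rewrite mulrBr mulr1 addrCA subrr addr0.
rewrite [X in X - _]addrC addrK.
by congr (_ *: _); apply: (@ksign_parity _ _ _ i); rewrite e; lia.
Qed.

End Evaluation.

(** A cofibrant replacement [p] of the free module behaves like the free module
    itself: with [sigma a = a rho], the composites [p sigma] and [sigma p] are
    homotopic to identities, the latter by [cofibrant_homotopy_lift].  So the
    maps out of [P] are, up to homotopy, the right multiples of [p], and the map
    [right_mul p x] takes the value [x] at [rho] up to a boundary. *)
Lemma evaluation_quasi_iso (k : comPzRingType) (A : dgalg k) (P N : dgmod A)
    (p : dgmod_hom P (regular A)) (rho : P 0) (crho : is_cycle rho) :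
  cofibrant_dgmod P -> quasi_iso p ->
  is_boundary ((p 0 rho : A 0) - one A) -> quasi_iso (evaluation N crho).
Proof.
move=> cP qp [b hb].
have pmul j (x : N j) : right_mul_fun p x (add0r j) rho =
    x + act N (add0r j) (diff A erefl b) x.
  rewrite /right_mul_fun mulr0 ksign0 scale1r -[X in X + _](act1 (add0r j) x).
  have := act_linearl (d := N) (add0r j) x 1 (one A) (diff A erefl b).
  by rewrite !scale1r => <-; rewrite hb addrC subrK.
have act_b_boundary j (x : N j) : is_cycle x ->
    is_boundary (act N (add0r j) (diff A erefl b) x).
  move=> cx; have q : 0 + 1 + j = j + 1 by rewrite add0r addrC.
  exists (act N q b x).
  have q' : 0 + 1 + (j - 1) = j by rewrite add0r addrC subrK.
  rewrite (act_leibniz q erefl (deg_pred j) erefl (add0r j) q') cx linear0.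
  by rewrite scaler0 addr0.
(* [g] is the identity minus [sigma p]; [p g] is the differential of [K]. *)
pose idP := ghom_of (dgmod_id P).
pose s := right_mul p rho : ghom P P 0.
pose g := idP - s : hom_complex P P 0.
have cg : is_cycle g.
  apply: cycleB; first exact: ghom_of_cycle.
  by move=> j e; rewrite /s [LHS]hom_diff_right_mul crho; apply: ghom_ext => i l q y /=;
    rewrite /right_mul_fun linear0 scaler0.
pose b1 : regular A 1 := b.
have hb1 : diff (regular A) deg1 b1 = (p 0 rho : A 0) - one A.
  by rewrite -hb; congr (diff _ _ _); apply: eq_irrelevance.
pose K : hom_complex P (regular A) 1 :=
  - (right_mul p b1 : hom_complex P (regular A) 1).
have dK : hom_diff deg1 K =
    - (right_mul p (diff (regular A) deg1 b1) : hom_complex P (regular A) 0).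
  rewrite -[LHS]/(diff (hom_complex P (regular A)) deg1 K) linearN.
  by congr (- _); apply: hom_diff_right_mul.
have [] := cofibrant_homotopy_lift (g := g) (K := K) cP qp cg.
  move=> i y; rewrite dK hb1 /= /right_mul_fun.
  rewrite ghom_of_funE linearB /= linearZ /= dgmod_hom_act /= mul0r ksign0 !scale1r.
  by rewrite linearB /= opprB mulx1.
move=> H gH.
apply/quasi_isoP; split=> n x cx; last first.
  exists (right_mul p x).
    by move=> j e; rewrite [LHS]hom_diff_right_mul cx; apply: ghom_ext => i l q y /=;
      rewrite /right_mul_fun linear0 scaler0.
  rewrite /= pmul opprD addrA subrr sub0r; apply: boundaryN.
  exact: act_b_boundary.
move=> [z hz].
have hgx : gcomp (add0r n) g x =
    x - right_mul p (gfun x (add0r n) rho) :> hom_complex P N n.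
  apply: ghom_ext => i j e y.
  rewrite [LHS](gcomp_funE _ _ _ e (addr0 i) e) /= ghom_of_funE linearB /=.
  congr (_ - _); rewrite /right_mul_fun linearZ /= mul0r ksign0 scale1r.
  by rewrite (gfun_act x _ (add0r n) e e).
have -> : x = gcomp (add0r n) g x
    + right_mul p (gfun x (add0r n) rho) :> hom_complex P N n.
  by rewrite hgx subrK.
apply: boundaryD; last first.
  by exists (right_mul p z); rewrite [LHS]hom_diff_right_mul hz.
have e1 : 1 + n = n + 1 by rewrite addrC.
have e2 : 1 + (n - 1) = n by rewrite addrC subrK.
exists (ksign n *: (gcomp e1 H x : hom_complex P N (n + 1))).
rewrite linearZ /= (hom_diff_gcomp _ deg1 (deg_pred n) erefl (add0r n) e2).
rewrite (_ : hom_diff (deg_pred n) x = 0); last exact: cx.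
rewrite -gH (_ : gcomp e2 H 0 = 0) ?add0r ?scalerA ?ksignK ?scale1r //.
by apply: ghom_ext => i j q y; rewrite /= /gcomp_fun.
Qed.

Section LeftMultiplication.
Variables (k : comPzRingType) (Y : dgalg k) (N : dgmod Y).

Lemma act0l i j l (e : i + j = l) (x : N j) : act N e 0 x = 0.
Proof.
have := act_linearl (d := N) e x (-1) 0 0.
by rewrite scaler0 addr0 scaleN1r addNr.
Qed.

Lemma act_diffl i j l (e : i + j = l) (a : Y i) (x : N j) i' l'
    (di : i = i' + 1) (dl : l = l' + 1) (el : i' + j = l') :
  is_cycle x -> diff N dl (act N e a x) = act N el (diff Y di a) x.
Proof.
move=> cx; have dj : j = j - 1 + 1 by rewrite subrK.
have er : i + (j - 1) = l' by lia.
by rewrite (act_leibniz e di dj dl el er) cx linear0 scaler0 addr0.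
Qed.

Variables (x : N 0) (cx : is_cycle x).

Lemma left_mul_diff i j (e : i = j + 1) (a : Y i) :
  act N (addr0 j) (diff Y e a) x = diff N e (act N (addr0 i) a x).
Proof.
by rewrite (act_diffl _ _ e _ (addr0 j) cx).
Qed.

Lemma left_mul_act i j l (e : i + j = l) (a : Y i) (y : Y j) :
  act N (addr0 l) (mul Y e a y) x = act N e a (act N (addr0 j) y x).
Proof. exact: actA. Qed.

Definition left_mul : dgmod_hom (regular Y) N :=
  @DGModHom k Y (regular Y) N
    (@ChainMap k Y N (fun n a => act N (addr0 n) a x)
      (fun n => act_linearl (d := N) (addr0 n) x) left_mul_diff)
    left_mul_act.

End LeftMultiplication.

(** * Triangular dg algebras *)

Record dgbimod (k : comPzRingType) (A B : dgalg k) := DGBimod {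
  dgbimod_mod :> dgmod A;
  ract : forall i j l : int, i + j = l ->
    dgbimod_mod i -> B j -> dgbimod_mod l;
  ract_linearl : forall i j l (e : i + j = l) b, linear (fun x => ract e x b);
  ract_linearr : forall i j l (e : i + j = l) x, linear (fun b => ract e x b);
  ractA : forall (a b c ab bc abc : int) (e1 : a + b = ab)
    (e2 : ab + c = abc) (e3 : b + c = bc) (e4 : a + bc = abc) x y z,
    ract e2 (ract e1 x y) z = ract e4 x (mul B e3 y z);
  ract1 : forall i (e : i + 0 = i) x, ract e x (one B) = x;
  act_ract : forall (a b c ab bc abc : int) (e1 : a + b = ab)
    (e2 : ab + c = abc) (e3 : b + c = bc) (e4 : a + bc = abc) x y z,
    ract e2 (act dgbimod_mod e1 x y) z = act dgbimod_mod e4 x (ract e3 y z);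
  ract_leibniz : forall (i j l i' j' l' : int) (e : i + j = l) (di : i = i' + 1)
    (dj : j = j' + 1) (dl : l = l' + 1) (el : i' + j = l') (er : i + j' = l')
    x b,
    diff dgbimod_mod dl (ract e x b) =
      ract el (diff dgbimod_mod di x) b
      + ksign i *: ract er x (diff B dj b) }.

Arguments ract {k A B} d {i j l} e x b.

HB.instance Definition _ (k : comPzRingType) (A B : dgalg k) (M : dgbimod A B)
    i j l (e : i + j = l) (x : M i) :=
  GRing.isLinear.Build k (B j) (M l) *:%R (ract M e x)
    (@ract_linearr k A B M i j l e x).

Section Triangular.
Variables (k : comPzRingType) (A B : dgalg k) (M : dgbimod A B).
Variables (m : M 0) (cm : is_cycle m).

(** An element of degree [n] consists of [a] and [b] of degree [n] and of a
    homotopy [h] of degree [n + 1] between [a m] and [m b].  These are the upper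
    triangular matrices with entries [a], [h], [b], the differential being
    twisted by the commutator with the off-diagonal matrix [m]. *)
Definition tri_deg n : lmodType k := (A n * B n * M (n + 1)%R)%type.

Lemma tri_al i j : i = j + 1 -> i + 0 = j + 1.
Proof. by move=> ->; rewrite addr0. Qed.

Lemma tri_bl i j : i = j + 1 -> 0 + i = j + 1.
Proof. by move=> ->; rewrite add0r. Qed.

Lemma ract0l i j l (e : i + j = l) (b : B j) : ract M e 0 b = 0.
Proof.
have := ract_linearl (d := M) e b (-1) 0 0.
by rewrite scaler0 addr0 scaleN1r addNr.
Qed.

Lemma ractBl i j l (e : i + j = l) (x y : M i) (b : B j) :
  ract M e (x - y) b = ract M e x b - ract M e y b.
Proof. by rewrite addrC -scaleN1r ract_linearl scaleN1r addrC. Qed.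

Lemma ract_diffr j l (e : 0 + j = l) (b : B j) (x : M 0) j' l'
    (dj : j = j' + 1) (dl : l = l' + 1) (er : 0 + j' = l') :
  is_cycle x -> diff M dl (ract M e x b) = ract M er x (diff B dj b).
Proof.
move=> cx; have di : 0 = - 1 + 1 :> int by [].
have el : - 1 + j = l' by lia.
by rewrite (ract_leibniz e di dj dl el er) cx ract0l add0r ksign0 scale1r.
Qed.

Definition tri_diff i j (e : i = j + 1) (t : tri_deg i) : tri_deg j :=
  (diff A e t.1.1, diff B e t.1.2,
   act M (tri_al e) t.1.1 m - ract M (tri_bl e) m t.1.2
     - diff M (deg_succ e) t.2).

Lemma tri_diff_linear i j (e : i = j + 1) : linear (tri_diff e).
Proof.
move=> c u v; apply: pair_ext; first by apply: pair_ext; rewrite /= linearP.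
rewrite /tri_diff /= !linearP /= act_linearl.
by rewrite !scalerDr [RHS]addrACA; congr (_ + _); rewrite [RHS]addrACA.
Qed.

Lemma tri_diff_diff i j l (e : i = j + 1) (e' : j = l + 1) t :
  tri_diff e' (tri_diff e t) = 0.
Proof.
apply: pair_ext; first by apply: pair_ext; rewrite /= diff_diff.
rewrite /= [diff M (deg_succ e') _]linearB /= diff_diff subr0.
rewrite [diff M (deg_succ e') _]linearB /=.
rewrite (act_diffl _ _ e _ (tri_al e') cm) (ract_diffr _ _ e _ (tri_bl e') cm).
by rewrite subrr.
Qed.

Definition tri_complex : complex k :=
  Complex tri_diff_linear tri_diff_diff.

Lemma succ_act i j l : i + j = l -> i + 1 + j = l + 1.
Proof. by move=> <-; rewrite addrAC. Qed.

Definition tri_mul i j l (e : i + j = l) (s : tri_complex i) (t : tri_complex j) :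
    tri_complex l :=
  (mul A e s.1.1 t.1.1, mul B e s.1.2 t.1.2,
   ksign i *: act M (act_succ e) s.1.1 t.2 + ract M (succ_act e) s.2 t.1.2).

Definition tri_one : tri_complex 0 := (one A, one B, 0).

Lemma tri_mul_linearl i j l (e : i + j = l) t : linear (fun s => tri_mul e s t).
Proof.
move=> c u v; apply: pair_ext.
  by apply: pair_ext; rewrite /= mul_linearl.
rewrite /= act_linearl ract_linearl !scalerDr addrACA !scalerA.
by rewrite [ksign i * c]mulrC.
Qed.

Lemma tri_mul_linearr i j l (e : i + j = l) s : linear (fun t => tri_mul e s t).
Proof.
move=> c u v; apply: pair_ext.
  by apply: pair_ext; rewrite /= mul_linearr.
rewrite /= [act M _ _ _]linearP [ract M _ _ _]linearP /= !scalerDr addrACA !scalerA.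
by rewrite [ksign i * c]mulrC.
Qed.

Lemma tri_mulA (a b c ab bc abc : int) (e1 : a + b = ab)
    (e2 : ab + c = abc) (e3 : b + c = bc) (e4 : a + bc = abc) x y z :
  tri_mul e2 (tri_mul e1 x y) z = tri_mul e4 x (tri_mul e3 y z).
Proof.
apply: pair_ext; first by apply: pair_ext; rewrite /=; apply: mulA.
rewrite /= ract_linearl [act M (act_succ e4) _ _]linearP /= scalerDr scalerA -ksignD e1.
rewrite (actA e1 _ (act_succ e3) (act_succ e4)) addrA.
rewrite (ractA _ _ e3 (succ_act e4)); congr (_ + _ *: _ + _).
exact: act_ract.
Qed.

Lemma tri_mul1x i (e : 0 + i = i) x : tri_mul e tri_one x = x.
Proof.
apply: pair_ext; first by apply: pair_ext; rewrite /= mul1x.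
by rewrite /= ract0l addr0 act1 ksign0 scale1r.
Qed.

Lemma tri_mulx1 i (e : i + 0 = i) x : tri_mul e x tri_one = x.
Proof.
apply: pair_ext; first by apply: pair_ext; rewrite /= mulx1.
by rewrite /= linear0 scaler0 add0r ract1.
Qed.

Lemma tri_mul_leibniz (i j l i' j' l' : int) (e : i + j = l) (di : i = i' + 1)
    (dj : j = j' + 1) (dl : l = l' + 1) (el : i' + j = l') (er : i + j' = l')
    x y :
  diff tri_complex dl (tri_mul e x y) =
    tri_mul el (diff tri_complex di x) y
    + ksign i *: tri_mul er x (diff tri_complex dj y).
Proof.
apply: pair_ext; first by apply: pair_ext; rewrite /=; apply: mul_leibniz.
rewrite /= linearD linearZ /=.
rewrite (act_leibniz (act_succ e) di (deg_succ dj) _ (act_succ el) (act_succ er)).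
rewrite (ract_leibniz (succ_act e) (deg_succ di) dj _ (succ_act el) (succ_act er)).
have si' : ksign i' = - ksign i :> k by rewrite di ksignD ksign1 mulrN1 opprK.
have -> : ksign (i + 1) = - ksign i :> k by rewrite ksignD ksign1 mulrN1.
rewrite si' !ractBl [act M _ _ (_ - diff M _ _)]linearB /=
  [act M _ _ (_ - ract M _ _ _)]linearB /= !scalerDr !scalerN.
rewrite !scalerA ksignK !scale1r !scaleNr.
rewrite (actA e (tri_al dl) (tri_al dj) (act_succ er)).
rewrite (ractA (tri_bl di) (succ_act el) e (tri_bl dl)).
rewrite (act_ract (tri_al di) (succ_act el) (tri_bl dj) (act_succ er)).
rewrite !opprD opprK [RHS](AC (1*3*4) ((2*6)*((5*3)*((1*7)*(4*8))))).
by rewrite /= subrr add0r.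
Qed.

Definition tri : dgalg k :=
  DGAlg tri_mul_linearl tri_mul_linearr tri_mulA tri_mul1x tri_mulx1
    tri_mul_leibniz.

Lemma tri_cycleP n (t : tri n) : is_cycle t <->
  [/\ is_cycle t.1.1, is_cycle t.1.2 &
      diff M erefl t.2 = act M (addr0 n) t.1.1 m - ract M (add0r n) m t.1.2].
Proof.
have [j e] : exists j, n = j + 1 by exists (n - 1); rewrite subrK.
subst n; split=> [ct | [ca cb h]].
  have h := ct _ erefl; move: (congr1 fst h) => /[dup] /(congr1 fst) /= h1.
  move=> /(congr1 snd) /= h2; move: (congr1 snd h) => /= h3; split.
  - exact: cycle1P h1.
  - exact: cycle1P h2.
  move/eqP: h3; rewrite subr_eq0 => /eqP h3.
  rewrite (eq_irrelevance (addr0 (j + 1)) (tri_al erefl)).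
  rewrite (eq_irrelevance (add0r (j + 1)) (tri_bl erefl)) h3.
  by rewrite (eq_irrelevance (deg_succ _) erefl).
apply: (cycle1P (e := erefl)).
apply: pair_ext; first by apply: pair_ext; rewrite /= ?ca ?cb.
rewrite /= (eq_irrelevance (deg_succ _) erefl) h.
rewrite (eq_irrelevance (addr0 (j + 1)) (tri_al erefl)).
by rewrite (eq_irrelevance (add0r (j + 1)) (tri_bl erefl)) subrr.
Qed.

Lemma tri_boundary n (t : tri n) (a : A (n + 1)) (b : B (n + 1))
    (h : M (n + 1 + 1)) :
  diff A erefl a = t.1.1 -> diff B erefl b = t.1.2 ->
  t.2 = act M (addr0 (n + 1)) a m - ract M (add0r (n + 1)) m b
          - diff M erefl h ->
  is_boundary t.
Proof.
move=> ha hb hh; exists (a, b, h).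
apply: pair_ext; first by apply: pair_ext.
rewrite hh /= (eq_irrelevance (deg_succ _) erefl).
rewrite (eq_irrelevance (addr0 (n + 1)) (tri_al erefl)).
by rewrite (eq_irrelevance (add0r (n + 1)) (tri_bl erefl)).
Qed.

Definition tri_projA : dgalg_hom tri A.
Proof.
unshelve refine (@DGAlgHom k tri A (@ChainMap k tri A (fun n t => t.1.1) _ _) _ _);
  by [].
Defined.

Definition tri_projB : dgalg_hom tri B.
Proof.
unshelve refine (@DGAlgHom k tri B (@ChainMap k tri B (fun n t => t.1.2) _ _) _ _);
  by [].
Defined.

Lemma tri_projA_surjective : surjective_map tri_projA.
Proof. by move=> n a; exists (a, 0, 0). Qed.

Lemma right_mul_map_diff i j (e : i = j + 1) (b : B i) :
  ract M (add0r j) m (diff B e b) = diff M e (ract M (add0r i) m b).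
Proof. by rewrite (ract_diffr _ _ e _ (add0r j) cm). Qed.

Definition right_mul_map : chain_map B M :=
  @ChainMap k B M (fun n b => ract M (add0r n) m b)
    (fun n => ract_linearr (d := M) (add0r n) m) right_mul_map_diff.

(** The fibre of the projection over [0] is, up to a shift, the cone of
    [b |-> m b], which is acyclic. *)
Lemma tri_projA_quasi_iso : quasi_iso right_mul_map -> quasi_iso tri_projA.
Proof.
move=> /quasi_isoP[mI mS]; apply/quasi_isoP; split=> n.
  move=> [[a b] h] /tri_cycleP[/= ca cb dh] [a0 ha0].
  have [b0 hb0] : is_boundary b.
    apply: mI => //=; exists (act M (addr0 (n + 1)) a0 m - h).
    by rewrite linearB /= -(left_mul_diff cm) ha0 dh opprB addrC subrK.
  pose w := act M (addr0 (n + 1)) a0 m - ract M (add0r (n + 1)) m b0 - h.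
  have cw : is_cycle w.
    apply: (cycle1P (e := erefl)); rewrite /w !linearB /= -(left_mul_diff cm).
    by rewrite -right_mul_map_diff ha0 hb0 dh subrr.
  have [b1 cb1 [x hx]] := mS _ _ cw.
  apply: (tri_boundary (a := a0) (b := b0 + b1) (h := x)) => //=.
    by rewrite linearD /= cb1 addr0.
  rewrite hx /w linearD /= !opprD !opprK.
  by rewrite [RHS](AC (1*2*4) (6*(1*4)*(2*5)*(3*7))) /= subrr !addNr !addr0.
move=> a ca.
have ca' := chain_map_cycle (left_mul cm) ca.
have [b cb [h hh]] := mS _ _ ca'.
exists (a, b, h); first by apply/tri_cycleP; split.
by rewrite /= subrr; apply: boundary0.
Qed.

(** The same with the roles of [A] and [B] exchanged. *)
Lemma tri_projB_quasi_iso : quasi_iso (left_mul cm) -> quasi_iso tri_projB.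
Proof.
move=> /quasi_isoP[mI mS]; apply/quasi_isoP; split=> n.
  move=> [[a b] h] /tri_cycleP[/= ca cb dh] [b0 hb0].
  have [a0 ha0] : is_boundary a.
    apply: mI => //=; exists (ract M (add0r (n + 1)) m b0 + h).
    by rewrite linearD /= -right_mul_map_diff hb0 dh addrC subrK.
  pose w := h + ract M (add0r (n + 1)) m b0 - act M (addr0 (n + 1)) a0 m.
  have cw : is_cycle w.
    apply: (cycle1P (e := erefl)); rewrite /w linearB linearD /= -(left_mul_diff cm).
    by rewrite -right_mul_map_diff ha0 hb0 dh subrK subrr.
  have [a1 ca1 [x hx]] := mS _ _ cw.
  apply: (tri_boundary (a := a0 + a1) (b := b0) (h := - x)) => //=.
    by rewrite linearD /= ca1 addr0.
  have := act_linearl (d := M) (addr0 (n + 1)) m 1 a0 a1.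
  rewrite linearN /= !scale1r hx /w => -> /=.
  by rewrite opprK [RHS](AC (3*4) (4*(1*6)*(2*7)*(5*3))) /= !subrr !addr0.
move=> b cb.
have cb' := chain_map_cycle right_mul_map cb.
have [a ca [h hh]] := mS _ _ cb'.
exists (a, b, - h).
  by apply/tri_cycleP; split => //=; rewrite linearN /= hh opprB.
by rewrite /= subrr; apply: boundary0.
Qed.

End Triangular.

Section TriangularMap.
Variables (k : comPzRingType) (A A' B : dgalg k).
Variables (M : dgbimod A B) (M' : dgbimod A' B) (f : dgalg_hom A A').
Variables (u : chain_map M M') (m : M 0) (m' : M' 0).
Variables (cm : is_cycle m) (cm' : is_cycle m').
Hypothesis u_act : forall i j l (e : i + j = l) (a : A i) (x : M j),
  u l (act M e a x) = act M' e (f i a) (u j x).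
Hypothesis u_ract : forall i j l (e : i + j = l) (x : M i) (b : B j),
  u l (ract M e x b) = ract M' e (u i x) b.
Hypothesis u_m : u 0 m = m'.

Definition tri_map_fun n (t : tri cm n) : tri cm' n :=
  (f n t.1.1, t.1.2, u (n + 1) t.2).

Lemma tri_map_linear n : linear (@tri_map_fun n).
Proof. by move=> c s t; rewrite /tri_map_fun /= !linearP. Qed.

Lemma tri_map_diff i j (e : i = j + 1) (t : tri cm i) :
  tri_map_fun (diff (tri cm) e t) = diff (tri cm') e (tri_map_fun t).
Proof.
apply: pair_ext; first by apply: pair_ext; rewrite //= cmap_diff.
by rewrite /= !linearB /= u_act u_ract u_m cmap_diff.
Qed.

Definition tri_map : dgalg_hom (tri cm) (tri cm').
Proof.
refine (@DGAlgHom k (tri cm) (tri cm')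
  (@ChainMap k (tri cm) (tri cm') tri_map_fun tri_map_linear tri_map_diff) _ _).
- move=> i j l e x y; apply: pair_ext.
    by apply: pair_ext; rewrite //= dgalg_hom_mul.
  by rewrite /= linearD linearZ /= u_act u_ract.
- apply: pair_ext; last by rewrite /= linear0.
  by apply: pair_ext; rewrite //= dgalg_hom_one.
Defined.

End TriangularMap.

(** * The endomorphism algebra acting from the right *)

Section Endomorphisms.
Variables (k : comPzRingType) (A : dgalg k) (R : dgmod A).

(** The opposite of composition, with the Koszul sign of the exchange. *)
Definition end_mul i j l (e : i + j = l) (x : hom_complex R R i)
    (y : hom_complex R R j) : hom_complex R R l := ksign (i * j) *: gcomp e x y.

Definition end_one : hom_complex R R 0 := ghom_of (dgmod_id R).

Lemma end_mul_linearl i j l (e : i + j = l) y : linear (fun x => end_mul e x y).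
Proof.
by move=> c u v; rewrite /end_mul gcompDl scalerDr !scalerA [ksign _ * c]mulrC.
Qed.

Lemma end_mul_linearr i j l (e : i + j = l) x : linear (fun y => end_mul e x y).
Proof.
by move=> c u v; rewrite /end_mul gcompDr scalerDr !scalerA [ksign _ * c]mulrC.
Qed.

Lemma gcompZl (L M N : dgmod A) (m n l : int) (e : m + n = l) (f : ghom L M m)
    (g : ghom M N n) c : gcomp e (c *: f) g = c *: gcomp e f g.
Proof. by apply: ghom_ext => i j p x /=; rewrite /gcomp_fun /= linearZ. Qed.

Lemma gcompZr (L M N : dgmod A) (m n l : int) (e : m + n = l) (f : ghom L M m)
    (g : ghom M N n) c : gcomp e f (c *: g) = c *: gcomp e f g.
Proof. by apply: ghom_ext => i j p x /=. Qed.

Lemma end_mulA (a b c ab bc abc : int) (e1 : a + b = ab)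
    (e2 : ab + c = abc) (e3 : b + c = bc) (e4 : a + bc = abc) x y z :
  end_mul e2 (end_mul e1 x y) z = end_mul e4 x (end_mul e3 y z).
Proof.
rewrite /end_mul gcompZl gcompZr (gcompA e1 e2 e3 e4) !scalerA -!ksignD.
by congr (_ *: _); apply: (@ksign_parity _ _ _ 0); rewrite -e1 -e3; lia.
Qed.

Lemma end_mul1x i (e : 0 + i = i) x : end_mul e end_one x = x.
Proof.
rewrite /end_mul mul0r ksign0 scale1r; apply: ghom_ext => j l q y.
by rewrite [LHS](gcomp_funE _ _ _ q (addr0 j) q) /= ghom_of_funE.
Qed.

Lemma end_mulx1 i (e : i + 0 = i) x : end_mul e x end_one = x.
Proof.
rewrite /end_mul mulr0 ksign0 scale1r; apply: ghom_ext => j l q y.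
by rewrite [LHS](gcomp_funE _ _ _ q q (addr0 l)) /= ghom_of_funE.
Qed.

Lemma end_mul_leibniz (i j l i' j' l' : int) (e : i + j = l) (di : i = i' + 1)
    (dj : j = j' + 1) (dl : l = l' + 1) (el : i' + j = l') (er : i + j' = l')
    x y :
  diff (hom_complex R R) dl (end_mul e x y) =
    end_mul el (diff (hom_complex R R) di x) y
    + ksign i *: end_mul er x (diff (hom_complex R R) dj y).
Proof.
rewrite /end_mul linearZ /= (hom_diff_gcomp e di dj dl el er).
rewrite scalerDr !scalerA -!ksignD addrC; congr (_ *: _ + _ *: _).
  by apply: (@ksign_parity _ _ _ j); rewrite di; lia.
by apply: (@ksign_parity _ _ _ 0); rewrite dj; lia.
Qed.

Definition end_alg : dgalg k :=
  DGAlg end_mul_linearl end_mul_linearr end_mulA end_mul1x end_mulx1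
    end_mul_leibniz.

Definition end_act i j l (e : i + j = l) (x : R i) (b : end_alg j) : R l :=
  ksign (i * j) *: gfun (b : ghom R R j) e x.

Lemma end_act_linearl i j l (e : i + j = l) b : linear (fun x => end_act e x b).
Proof.
by move=> c u v; rewrite /end_act linearP scalerDr !scalerA [ksign _ * c]mulrC.
Qed.

Lemma end_act_linearr i j l (e : i + j = l) x : linear (fun b => end_act e x b).
Proof.
by move=> c u v; rewrite /end_act /= scalerDr !scalerA [ksign _ * c]mulrC.
Qed.

Lemma end_actA (a b c ab bc abc : int) (e1 : a + b = ab)
    (e2 : ab + c = abc) (e3 : b + c = bc) (e4 : a + bc = abc) x y z :
  end_act e2 (end_act e1 x y) z = end_act e4 x (mul end_alg e3 y z).
Proof.
rewrite /end_act linearZ /= (gcomp_funE e3 y z e4 e1 e2) !scalerA -!ksignD.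
by congr (_ *: _); apply: (@ksign_parity _ _ _ 0); rewrite -e1 -e3; lia.
Qed.

Lemma end_act1 i (e : i + 0 = i) x : end_act e x (one end_alg) = x.
Proof. by rewrite /end_act mulr0 ksign0 scale1r /= ghom_of_funE. Qed.

Lemma act_end_act (a b c ab bc abc : int) (e1 : a + b = ab)
    (e2 : ab + c = abc) (e3 : b + c = bc) (e4 : a + bc = abc) x y z :
  end_act e2 (act R e1 x y) z = act R e4 x (end_act e3 y z).
Proof.
rewrite /end_act (gfun_act z e1 e3 e2 e4) [act R e4 x (_ *: _)]linearZ /=.
rewrite scalerA -ksignD.
by congr (_ *: _); apply: (@ksign_parity _ _ _ (a * c)); rewrite -e1; lia.
Qed.

Lemma end_act_leibniz (i j l i' j' l' : int) (e : i + j = l) (di : i = i' + 1)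
    (dj : j = j' + 1) (dl : l = l' + 1) (el : i' + j = l') (er : i + j' = l')
    x b :
  diff R dl (end_act e x b) =
    end_act el (diff R di x) b
    + ksign i *: end_act er x (diff end_alg dj b).
Proof.
rewrite /end_act [diff R dl _]linearZ /= (hom_diff_funE dj b er dl di e el).
rewrite scalerBr !scalerA !scalerBr !scalerA -!ksignD.
have -> : ksign (i + i * j') = ksign (i * j) :> k.
  by apply: (@ksign_parity _ _ _ 0); rewrite dj; lia.
have -> : ksign (i + (i * j' + j)) = ksign (i' * j) :> k.
  by apply: (@ksign_parity _ _ _ j); rewrite dj di; lia.
by rewrite [RHS]addrC subrK.
Qed.

Definition end_bimod : dgbimod A end_alg :=
  DGBimod end_act_linearl end_act_linearr end_actA end_act1 act_end_act
    end_act_leibniz.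

End Endomorphisms.

(** * Restriction and extension of scalars *)

Section RestrictedModule.
Variables (k : comPzRingType) (A Y : dgalg k) (f : dgalg_hom A Y) (N : dgmod Y).

Definition res_act i j l (e : i + j = l) (a : A i) (x : N j) : N l :=
  act N e (f i a) x.

Lemma res_act_linearl i j l (e : i + j = l) x : linear (fun a => res_act e a x).
Proof. by move=> c a b; rewrite /res_act linearP act_linearl. Qed.

Lemma res_act_linearr i j l (e : i + j = l) a : linear (fun x => res_act e a x).
Proof. exact: act_linearr. Qed.

Lemma res_actA (a b c ab bc abc : int) (e1 : a + b = ab)
    (e2 : ab + c = abc) (e3 : b + c = bc) (e4 : a + bc = abc) x y z :
  res_act e2 (mul A e1 x y) z = res_act e4 x (res_act e3 y z).
Proof. by rewrite /res_act dgalg_hom_mul; apply: actA. Qed.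

Lemma res_act1 i (e : 0 + i = i) x : res_act e (one A) x = x.
Proof. by rewrite /res_act dgalg_hom_one act1. Qed.

Lemma res_act_leibniz (i j l i' j' l' : int) (e : i + j = l) (di : i = i' + 1)
    (dj : j = j' + 1) (dl : l = l' + 1) (el : i' + j = l') (er : i + j' = l')
    a x :
  diff N dl (res_act e a x) =
    res_act el (diff A di a) x + ksign i *: res_act er a (diff N dj x).
Proof. by rewrite /res_act (act_leibniz e di dj dl el er) cmap_diff. Qed.

Definition res_mod : dgmod A :=
  DGMod res_act_linearl res_act_linearr res_actA res_act1 res_act_leibniz.

End RestrictedModule.

Section TensorModule.
Variables (k : comPzRingType) (A Y : dgalg k) (f : dgalg_hom A Y) (R : dgmod A).

(** Families of maps on [Y i * R j], for [i + j = n], that factor through the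
    degree [n] part of the tensor product [Y (x)_A R]. *)
Record balanced n (L : lmodType k) := Balanced {
  bal_fun :> forall i j, i + j = n -> Y i -> R j -> L;
  bal_linearl : forall i j (e : i + j = n) y, linear (fun x => bal_fun e x y);
  bal_linearr : forall i j (e : i + j = n) x, linear (fun y => bal_fun e x y);
  bal_act : forall (a b c ab bc : int) (e1 : a + b = ab) (e2 : ab + c = n)
    (e3 : b + c = bc) (e4 : a + bc = n) (x : Y a) (z : A b) (y : R c),
    bal_fun e2 (mul Y e1 x (f b z)) y = bal_fun e4 x (act R e3 z y) }.

Record simple_tensor n := SimpleTensor {
  st_i : int; st_j : int; st_e : st_i + st_j = n; st_x : Y st_i; st_y : R st_j }.

HB.instance Definition _ n := gen_eqMixin (simple_tensor n).
HB.instance Definition _ n := gen_choiceMixin (simple_tensor n).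

Definition bal_sum n (L : lmodType k) (b : balanced n L)
    (s : seq (simple_tensor n)) : L :=
  \sum_(t <- s) b _ _ (st_e t) (st_x t) (st_y t).

(** Formal sums of simple tensors are identified when no balanced family
    distinguishes them.  The universal property and all identities between
    tensors thus hold by definition. *)
Definition tensor_eq n (s t : seq (simple_tensor n)) : bool :=
  `[< forall (L : lmodType k) (b : balanced n L), bal_sum b s = bal_sum b t >].

Lemma tensor_eq_refl n : reflexive (@tensor_eq n).
Proof. by move=> s; apply/asboolP. Qed.

Lemma tensor_eq_sym n : symmetric (@tensor_eq n).
Proof. by move=> s t; apply/asboolP/asboolP => h L b; rewrite h. Qed.

Lemma tensor_eq_trans n : transitive (@tensor_eq n).
Proof.
by move=> t s r /asboolP h1 /asboolP h2; apply/asboolP => L b; rewrite h1 h2.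
Qed.

Canonical tensor_equiv n := EquivRel (@tensor_eq n) (@tensor_eq_refl n)
  (@tensor_eq_sym n) (@tensor_eq_trans n).

Definition tensor n := {eq_quot @tensor_eq n}.
HB.instance Definition _ n := Choice.on (tensor n).

Definition tensor_lift n (L : lmodType k) (b : balanced n L) (u : tensor n) : L :=
  bal_sum b (repr u).

Lemma tensor_lift_pi n L (b : balanced n L) s :
  tensor_lift b (\pi_(tensor n) s) = bal_sum b s.
Proof.
have /eqquotP/asboolP h : \pi_(tensor n) (repr (\pi_(tensor n) s)) = \pi_(tensor n) s.
  by rewrite reprK.
exact: h.
Qed.

Lemma tensor_ext n (u v : tensor n) :
  (forall L (b : balanced n L), tensor_lift b u = tensor_lift b v) -> u = v.
Proof.
move=> h; rewrite -[u]reprK -[v]reprK; apply/eqquotP/asboolP => L b.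
exact: h.
Qed.

Definition tensor_zero n : tensor n := \pi_(tensor n) [::].
Definition tensor_add n (u v : tensor n) : tensor n :=
  \pi_(tensor n) (repr u ++ repr v).
Definition tensor_scale n c (u : tensor n) : tensor n :=
  \pi_(tensor n) [seq SimpleTensor (st_e t) (c *: st_x t) (st_y t) | t <- repr u].
Definition tensor_opp n (u : tensor n) := tensor_scale (-1) u.

Lemma tensor_lift_zero n L (b : balanced n L) : tensor_lift b (tensor_zero n) = 0.
Proof. by rewrite tensor_lift_pi /bal_sum big_nil. Qed.

Lemma tensor_lift_add n L (b : balanced n L) u v :
  tensor_lift b (tensor_add u v) = tensor_lift b u + tensor_lift b v.
Proof. by rewrite tensor_lift_pi /bal_sum big_cat. Qed.

Lemma bal_Zl n L (b : balanced n L) i j (e : i + j = n) c x y :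
  b _ _ e (c *: x) y = c *: b _ _ e x y.
Proof.
have b0 : b _ _ e 0 y = 0.
  have := bal_linearl b e y (-1) 0 0.
  by rewrite scaler0 addr0 scaleN1r addNr.
by have := bal_linearl b e y c x 0; rewrite !addr0 b0 addr0.
Qed.

Lemma tensor_lift_scale n L (b : balanced n L) c u :
  tensor_lift b (tensor_scale c u) = c *: tensor_lift b u.
Proof.
rewrite tensor_lift_pi /tensor_lift /bal_sum big_map scaler_sumr.
by apply: eq_bigr => t _ /=; rewrite bal_Zl.
Qed.

Let tensor_liftE := (tensor_lift_zero, tensor_lift_add, tensor_lift_scale).

Lemma tensor_addA n : associative (@tensor_add n).
Proof. by move=> u v w; apply: tensor_ext => L b; rewrite !tensor_liftE addrA. Qed.
Lemma tensor_addC n : commutative (@tensor_add n).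
Proof. by move=> u v; apply: tensor_ext => L b; rewrite !tensor_liftE addrC. Qed.
Lemma tensor_add0 n : left_id (tensor_zero n) (@tensor_add n).
Proof. by move=> u; apply: tensor_ext => L b; rewrite !tensor_liftE add0r. Qed.
Lemma tensor_addN n : left_inverse (tensor_zero n) (@tensor_opp n) (@tensor_add n).
Proof.
by move=> u; apply: tensor_ext => L b; rewrite !tensor_liftE scaleN1r addNr.
Qed.

HB.instance Definition _ n := GRing.isZmodule.Build (tensor n)
  (@tensor_addA n) (@tensor_addC n) (@tensor_add0 n) (@tensor_addN n).

Lemma tensor_scaleA n a b (u : tensor n) :
  tensor_scale a (tensor_scale b u) = tensor_scale (a * b) u.
Proof. by apply: tensor_ext => L d; rewrite !tensor_liftE scalerA. Qed.
Lemma tensor_scale1 n : left_id 1 (@tensor_scale n).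
Proof. by move=> u; apply: tensor_ext => L b; rewrite !tensor_liftE scale1r. Qed.
Lemma tensor_scaleDr n : right_distributive (@tensor_scale n) +%R.
Proof. by move=> a u v; apply: tensor_ext => L b; rewrite !tensor_liftE scalerDr. Qed.
Lemma tensor_scaleDl n (u : tensor n) : {morph (@tensor_scale n)^~ u : a b / a + b}.
Proof. by move=> a c; apply: tensor_ext => L b; rewrite !tensor_liftE scalerDl. Qed.

HB.instance Definition _ n := GRing.Zmodule_isLmodule.Build k (tensor n)
  (@tensor_scaleA n) (@tensor_scale1 n) (@tensor_scaleDr n) (@tensor_scaleDl n).

Lemma tensor_lift_linear n L (b : balanced n L) : linear (tensor_lift b).
Proof. by move=> c u v; rewrite tensor_lift_add tensor_lift_scale. Qed.

HB.instance Definition _ n L (b : balanced n L) :=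
  GRing.isLinear.Build k (tensor n) L *:%R (tensor_lift b) (tensor_lift_linear b).

Definition tensor_pure n i j (e : i + j = n) (x : Y i) (y : R j) : tensor n :=
  \pi_(tensor n) [:: SimpleTensor e x y].

Lemma tensor_lift_pure n L (b : balanced n L) i j (e : i + j = n) x y :
  tensor_lift b (tensor_pure e x y) = b _ _ e x y.
Proof. by rewrite tensor_lift_pi /bal_sum big_seq1. Qed.

Lemma pure_linearl n i j (e : i + j = n) y : linear (fun x => tensor_pure e x y).
Proof.
move=> c x x'; apply: tensor_ext => L b.
by rewrite tensor_lift_linear !tensor_lift_pure bal_linearl.
Qed.

Lemma pure_linearr n i j (e : i + j = n) x : linear (fun y => tensor_pure e x y).
Proof.
move=> c y y'; apply: tensor_ext => L b.
by rewrite tensor_lift_linear !tensor_lift_pure bal_linearr.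
Qed.

Lemma pure_act n (a b c ab bc : int) (e1 : a + b = ab) (e2 : ab + c = n)
    (e3 : b + c = bc) (e4 : a + bc = n) (x : Y a) (z : A b) (y : R c) :
  tensor_pure e2 (mul Y e1 x (f b z)) y = tensor_pure e4 x (act R e3 z y).
Proof.
by apply: tensor_ext => L d; rewrite !tensor_lift_pure (bal_act d e1 e2 e3 e4).
Qed.

Lemma tensor_ind n (P : tensor n -> Prop) :
  P 0 -> (forall u v, P u -> P v -> P (u + v)) ->
  (forall i j (e : i + j = n) x y, P (tensor_pure e x y)) -> forall u, P u.
Proof.
move=> P0 PD Pp u.
have -> : u = \sum_(t <- repr u) tensor_pure (st_e t) (st_x t) (st_y t).
  apply: tensor_ext => L b; rewrite linear_sum [LHS]/(bal_sum b (repr u)).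
  by apply: eq_bigr => t _; rewrite [RHS]tensor_lift_pure.
by apply: big_ind => // t _; apply: Pp.
Qed.

End TensorModule.

Section TensorDGModule.
Variables (k : comPzRingType) (A Y : dgalg k) (f : dgalg_hom A Y) (R : dgmod A).

Local Notation T := (tensor f R).
Local Notation pure := (@tensor_pure k A Y f R _ _ _).

HB.instance Definition _ n i j (e : i + j = n) x :=
  GRing.isLinear.Build k (R j) (T n) *:%R (@tensor_pure k A Y f R n i j e x)
    (@pure_linearr k A Y f R n i j e x).

Lemma pureZl n i j (e : i + j = n) c x y : pure e (c *: x) y = c *: pure e x y.
Proof.
have p0 : pure e 0 y = 0.
  have := pure_linearl f e y (-1) 0 0.
  by rewrite scaler0 addr0 scaleN1r addNr.
by have := pure_linearl f e y c x 0; rewrite !addr0 p0 addr0.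
Qed.

Lemma pureDl n i j (e : i + j = n) x x' y :
  pure e (x + x') y = pure e x y + pure e x' y.
Proof. by have := pure_linearl f e y 1 x x'; rewrite !scale1r. Qed.

Section Diff.
Variables (n m : int) (e : n = m + 1).

Lemma tensor_diff_degl i j : i + j = n -> i - 1 + j = m.
Proof. by move=> h; rewrite addrAC h e addrK. Qed.

Lemma tensor_diff_degr i j : i + j = n -> i + (j - 1) = m.
Proof. by move=> h; rewrite addrA h e addrK. Qed.

Definition tensor_diff_fun i j (p : i + j = n) (x : Y i) (y : R j) : T m :=
  pure (tensor_diff_degl p) (diff Y (deg_pred i) x) y
  + ksign i *: pure (tensor_diff_degr p) x (diff R (deg_pred j) y).

Lemma tensor_diff_funE (i j i' j' : int) (p : i + j = n) (di : i = i' + 1)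
    (dj : j = j' + 1) (el : i' + j = m) (er : i + j' = m) x y :
  tensor_diff_fun p x y = pure el (diff Y di x) y
    + ksign i *: pure er x (diff R dj y).
Proof.
have E : i' = i - 1 by lia.
have E' : j' = j - 1 by lia.
move: di el dj er; rewrite E E' /tensor_diff_fun => di el dj er.
rewrite (eq_irrelevance (deg_pred i) di) (eq_irrelevance (deg_pred j) dj).
rewrite (eq_irrelevance (tensor_diff_degl p) el).
by rewrite (eq_irrelevance (tensor_diff_degr p) er).
Qed.

Lemma tensor_diff_linearl i j (p : i + j = n) y :
  linear (fun x => tensor_diff_fun p x y).
Proof.
move=> c x x'; rewrite /tensor_diff_fun linearP !pureDl !pureZl.
by rewrite !scalerDr !scalerA addrACA [ksign i * c]mulrC.
Qed.

Lemma tensor_diff_linearr i j (p : i + j = n) x :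
  linear (fun y => tensor_diff_fun p x y).
Proof.
move=> c y y'; rewrite /tensor_diff_fun !linearP /=.
by rewrite !scalerDr addrACA.
Qed.

(** Both sides expand by the Leibniz rule into the three terms in which one of
    [x], [z], [y] is differentiated, and these agree in pairs. *)
Lemma tensor_diff_act (a b c ab bc : int) (e1 : a + b = ab) (e2 : ab + c = n)
    (e3 : b + c = bc) (e4 : a + bc = n) (x : Y a) (z : A b) (y : R c) :
  tensor_diff_fun e2 (mul Y e1 x (f b z)) y =
  tensor_diff_fun e4 x (act R e3 z y).
Proof.
have q1 : a - 1 + b = ab - 1 by lia.
have q2 : a + (b - 1) = ab - 1 by lia.
have q3 : b - 1 + c = bc - 1 by lia.
have q4 : b + (c - 1) = bc - 1 by lia.
have q5 : ab - 1 + c = m by lia.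
have q6 : ab + (c - 1) = m by lia.
have q7 : a - 1 + bc = m by lia.
have q8 : a + (bc - 1) = m by lia.
rewrite (tensor_diff_funE e2 (deg_pred ab) (deg_pred c) q5 q6).
rewrite (tensor_diff_funE e4 (deg_pred a) (deg_pred bc) q7 q8).
rewrite (mul_leibniz e1 (deg_pred a) (deg_pred b) (deg_pred ab) q1 q2).
rewrite (act_leibniz e3 (deg_pred b) (deg_pred c) (deg_pred bc) q3 q4).
rewrite pureDl pureZl linearD linearZ /= scalerDr scalerA -ksignD e1.
rewrite -cmap_diff (pure_act f q1 q5 e3 q7) (pure_act f q2 q5 q3 q8).
by rewrite (pure_act f e1 q6 q4 q8) addrA.
Qed.

Definition tensor_diff_bal : balanced f R n (T m) :=
  Balanced tensor_diff_linearl tensor_diff_linearr tensor_diff_act.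

Definition tensor_diff : T n -> T m := tensor_lift tensor_diff_bal.

Lemma tensor_diff_linear : linear tensor_diff.
Proof. exact: tensor_lift_linear. Qed.

Lemma tensor_diff_pure (i j i' j' : int) (p : i + j = n) (di : i = i' + 1)
    (dj : j = j' + 1) (el : i' + j = m) (er : i + j' = m) x y :
  tensor_diff (pure p x y) = pure el (diff Y di x) y
    + ksign i *: pure er x (diff R dj y).
Proof.
by rewrite /tensor_diff tensor_lift_pure /= (tensor_diff_funE p di dj el er).
Qed.

End Diff.

HB.instance Definition _ n m (e : n = m + 1) :=
  GRing.isLinear.Build k (T n) (T m) *:%R (tensor_diff e) (tensor_diff_linear e).

Lemma tensor_diff_diff n m l (e : n = m + 1) (e' : m = l + 1) u :
  tensor_diff e' (tensor_diff e u) = 0.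
Proof.
elim/tensor_ind: u => [|u v hu hv|i j p x y]; first by rewrite !linear0.
  by rewrite !linearD /= hu hv addr0.
have q1 : i - 1 + j = m by lia.
have q2 : i + (j - 1) = m by lia.
have q3 : i - 1 - 1 + j = l by lia.
have q4 : i - 1 + (j - 1) = l by lia.
have q5 : i + (j - 1 - 1) = l by lia.
rewrite (tensor_diff_pure e p (deg_pred i) (deg_pred j) q1 q2) linearD linearZ /=.
rewrite (tensor_diff_pure e' q1 (deg_pred (i - 1)) (deg_pred j) q3 q4).
rewrite (tensor_diff_pure e' q2 (deg_pred i) (deg_pred (j - 1)) q4 q5).
rewrite !diff_diff linear0 scaler0 addr0.
have -> : pure q3 0 y = 0 by have := pureZl q3 0 0 y; rewrite !scale0r.
rewrite add0r ksignD ksignN ksign1 mulrN1 scaleNr addNr.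
by [].
Qed.

Definition tensor_complex : complex k :=
  @Complex k (fun n => T n) tensor_diff tensor_diff_linear tensor_diff_diff.

Section Act.
Variables (i n l : int) (e : i + n = l) (a : Y i).

Lemma tensor_act_deg p q : p + q = n -> i + p + q = l.
Proof. by move=> h; rewrite -addrA h. Qed.

Definition tensor_act_fun p q (h : p + q = n) (x : Y p) (y : R q) : T l :=
  pure (tensor_act_deg h) (mul Y erefl a x) y.

Lemma tensor_act_funE (p q r : int) (h : p + q = n) (h1 : i + p = r)
    (h2 : r + q = l) x y :
  tensor_act_fun h x y = pure h2 (mul Y h1 a x) y.
Proof.
by subst r; rewrite /tensor_act_fun (eq_irrelevance (tensor_act_deg h) h2).
Qed.

Lemma tensor_act_fun_linearl p q (h : p + q = n) y :
  linear (fun x => tensor_act_fun h x y).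
Proof.
by move=> c x x'; rewrite /tensor_act_fun linearP pureDl pureZl.
Qed.

Lemma tensor_act_fun_linearr p q (h : p + q = n) x :
  linear (fun y => tensor_act_fun h x y).
Proof. by move=> c y y'; rewrite /tensor_act_fun linearP. Qed.

Lemma tensor_act_fun_act (b c d bc cd : int) (e1 : b + c = bc) (e2 : bc + d = n)
    (e3 : c + d = cd) (e4 : b + cd = n) (x : Y b) (z : A c) (y : R d) :
  tensor_act_fun e2 (mul Y e1 x (f c z)) y = tensor_act_fun e4 x (act R e3 z y).
Proof.
have q1 : i + b + c = i + bc by lia.
rewrite /tensor_act_fun -(mulA erefl q1 e1 erefl).
by rewrite (pure_act f q1 _ e3 (tensor_act_deg e4)).
Qed.

Definition tensor_act_bal : balanced f R n (T l) :=
  Balanced tensor_act_fun_linearl tensor_act_fun_linearr tensor_act_fun_act.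

Definition tensor_act (u : tensor_complex n) : tensor_complex l :=
  tensor_lift tensor_act_bal u.

Lemma tensor_act_linearr : linear tensor_act.
Proof. exact: tensor_lift_linear. Qed.

Lemma tensor_act_pure (p q r : int) (h : p + q = n) (h1 : i + p = r)
    (h2 : r + q = l) x y :
  tensor_act (pure h x y) = pure h2 (mul Y h1 a x) y.
Proof. by rewrite /tensor_act tensor_lift_pure /= (tensor_act_funE h h1 h2). Qed.

End Act.

HB.instance Definition _ i n l (e : i + n = l) a :=
  GRing.isLinear.Build k (T n) (T l) *:%R (tensor_act e a) (tensor_act_linearr e a).

Lemma tensor_act_linearl i n l (e : i + n = l) u : linear (fun a => tensor_act e a u).
Proof.
move=> c a b; elim/tensor_ind: u => [|u v hu hv|p q h x y].
- by rewrite !linear0 ?scaler0 addr0.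
- by rewrite !linearD /= hu hv addrACA.
have h2 : i + p + q = l by lia.
by rewrite !(tensor_act_pure _ _ h erefl h2) mul_linearl pureDl pureZl.
Qed.

Lemma tensor_actA (a b c ab bc abc : int) (e1 : a + b = ab)
    (e2 : ab + c = abc) (e3 : b + c = bc) (e4 : a + bc = abc) x y u :
  tensor_act e2 (mul Y e1 x y) u = tensor_act e4 x (tensor_act e3 y u).
Proof.
elim/tensor_ind: u => [|u v hu hv|p q h z w].
- by rewrite !linear0.
- by rewrite !linearD /= hu hv.
have h2 : ab + p + q = abc by lia.
have h3 : b + p + q = bc by lia.
have h4 : a + (b + p) = ab + p by lia.
rewrite (tensor_act_pure _ _ h erefl h2) (tensor_act_pure _ _ h erefl h3).
by rewrite (tensor_act_pure _ _ h3 h4 h2) (mulA e1 _ erefl h4).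
Qed.

Lemma tensor_act1 i (e : 0 + i = i) u : tensor_act e (one Y) u = u.
Proof.
elim/tensor_ind: u => [|u v hu hv|p q h z w].
- by rewrite linear0.
- by rewrite linearD /= hu hv.
by rewrite (tensor_act_pure _ _ h (add0r p) h) mul1x.
Qed.

Lemma tensor_act_leibniz (i j l i' j' l' : int) (e : i + j = l) (di : i = i' + 1)
    (dj : j = j' + 1) (dl : l = l' + 1) (el : i' + j = l') (er : i + j' = l')
    a u :
  diff tensor_complex dl (tensor_act e a u) =
    tensor_act el (diff Y di a) u
    + ksign i *: tensor_act er a (diff tensor_complex dj u).
Proof.
elim/tensor_ind: u => [|u v hu hv|p q h x y].
- by rewrite !linear0 ?scaler0 addr0.
- by move: hu hv => /= hu hv; rewrite !linearD /= hu hv addrACA.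
have q1 : i + p + q = l by lia.
have q2 : i' + p + q = l' by lia.
have q3 : i + p + (q - 1) = l' by lia.
have q4 : p - 1 + q = j' by lia.
have q5 : p + (q - 1) = j' by lia.
have q6 : i + p = i' + p + 1 by lia.
have q7 : i + (p - 1) = i' + p by lia.
rewrite (tensor_act_pure _ _ h erefl q1) (tensor_act_pure _ _ h erefl q2) /=.
rewrite (tensor_diff_pure _ _ q6 (deg_pred q) q2 q3).
rewrite (tensor_diff_pure _ _ (deg_pred p) (deg_pred q) q4 q5) linearD linearZ /=.
rewrite (tensor_act_pure _ _ q4 q7 q2) (tensor_act_pure _ _ q5 erefl q3).
rewrite (mul_leibniz erefl di (deg_pred p) q6 erefl q7) pureDl pureZl.
by rewrite scalerDr scalerA -ksignD addrA.
Qed.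

Definition tensor_mod : dgmod Y :=
  @DGMod k Y tensor_complex tensor_act tensor_act_linearl tensor_act_linearr
    tensor_actA tensor_act1 tensor_act_leibniz.

End TensorDGModule.

Section TensorBimodule.
Variables (k : comPzRingType) (A B Y : dgalg k) (f : dgalg_hom A Y).
Variables (R : dgbimod A B).

Local Notation T := (tensor f R).
Local Notation pure := (@tensor_pure k A Y f R _ _ _).

Section RAct.
Variables (n j l : int) (e : n + j = l) (b : B j).

Lemma tensor_ract_deg p q : p + q = n -> p + (q + j) = l.
Proof. by move=> h; rewrite addrA h. Qed.

Definition tensor_ract_fun p q (h : p + q = n) (x : Y p) (y : R q) : T l :=
  pure (tensor_ract_deg h) x (ract R erefl y b).

Lemma tensor_ract_funE (p q r : int) (h : p + q = n) (h1 : q + j = r)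
    (h2 : p + r = l) x y :
  tensor_ract_fun h x y = pure h2 x (ract R h1 y b).
Proof.
by subst r; rewrite /tensor_ract_fun (eq_irrelevance (tensor_ract_deg h) h2).
Qed.

Lemma tensor_ract_fun_linearl p q (h : p + q = n) y :
  linear (fun x => tensor_ract_fun h x y).
Proof. by move=> c x x'; rewrite /tensor_ract_fun pureDl pureZl. Qed.

Lemma tensor_ract_fun_linearr p q (h : p + q = n) x :
  linear (fun y => tensor_ract_fun h x y).
Proof. by move=> c y y'; rewrite /tensor_ract_fun ract_linearl linearP. Qed.

Lemma tensor_ract_fun_act (a c d ac cd : int) (e1 : a + c = ac) (e2 : ac + d = n)
    (e3 : c + d = cd) (e4 : a + cd = n) (x : Y a) (z : A c) (y : R d) :
  tensor_ract_fun e2 (mul Y e1 x (f c z)) y = tensor_ract_fun e4 x (act R e3 z y).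
Proof.
have q1 : c + (d + j) = cd + j by lia.
rewrite /tensor_ract_fun (act_ract e3 erefl erefl q1).
by rewrite (pure_act f e1 _ q1 (tensor_ract_deg e4)).
Qed.

Definition tensor_ract_bal : balanced f R n (T l) :=
  Balanced tensor_ract_fun_linearl tensor_ract_fun_linearr tensor_ract_fun_act.

Definition tensor_ract (u : tensor_mod f R n) : tensor_mod f R l :=
  tensor_lift tensor_ract_bal u.

Lemma tensor_ract_linearl : linear tensor_ract.
Proof. exact: tensor_lift_linear. Qed.

Lemma tensor_ract_pure (p q r : int) (h : p + q = n) (h1 : q + j = r)
    (h2 : p + r = l) x y :
  tensor_ract (pure h x y) = pure h2 x (ract R h1 y b).
Proof. by rewrite /tensor_ract tensor_lift_pure /= (tensor_ract_funE h h1 h2). Qed.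

End RAct.

HB.instance Definition _ n j l (e : n + j = l) b :=
  GRing.isLinear.Build k (T n) (T l) *:%R (tensor_ract e b)
    (tensor_ract_linearl e b).

Definition tensor_rmul n j l (e : n + j = l) (u : tensor_mod f R n) (b : B j) :=
  tensor_ract e b u.

Lemma tensor_rmul_linearl n j l (e : n + j = l) b :
  linear (fun u => tensor_rmul e u b).
Proof. exact: tensor_ract_linearl. Qed.

Lemma tensor_rmul_linearr n j l (e : n + j = l) u :
  linear (fun b => tensor_rmul e u b).
Proof.
move=> c a b; rewrite /tensor_rmul.
elim/tensor_ind: u => [|u v hu hv|p q h x y].
- by rewrite !linear0 ?scaler0 addr0.
- by rewrite !linearD /= hu hv addrACA.
have h2 : p + (q + j) = l by lia.
by rewrite !(tensor_ract_pure _ _ h erefl h2) linearP /= linearP.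
Qed.

Lemma tensor_rmulA (a b c ab bc abc : int) (e1 : a + b = ab)
    (e2 : ab + c = abc) (e3 : b + c = bc) (e4 : a + bc = abc) u y z :
  tensor_rmul e2 (tensor_rmul e1 u y) z = tensor_rmul e4 u (mul B e3 y z).
Proof.
rewrite /tensor_rmul; elim/tensor_ind: u => [|u v hu hv|p q h x w].
- by rewrite !linear0.
- by rewrite !linearD /= hu hv.
have h2 : p + (q + b) = ab by lia.
have h3 : q + bc = q + b + c by lia.
have h4 : p + (q + b + c) = abc by lia.
rewrite (tensor_ract_pure _ _ h erefl h2) (tensor_ract_pure _ _ h2 erefl h4).
by rewrite (tensor_ract_pure _ _ h h3 h4) (ractA _ _ e3 h3).
Qed.

Lemma tensor_rmul1 i (e : i + 0 = i) u : tensor_rmul e u (one B) = u.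
Proof.
rewrite /tensor_rmul; elim/tensor_ind: u => [|u v hu hv|p q h x w].
- by rewrite !linear0.
- by rewrite !linearD /= hu hv.
by rewrite (tensor_ract_pure _ _ h (addr0 q) h) ract1.
Qed.

Lemma tensor_act_rmul (a b c ab bc abc : int) (e1 : a + b = ab)
    (e2 : ab + c = abc) (e3 : b + c = bc) (e4 : a + bc = abc) x u z :
  tensor_rmul e2 (act (tensor_mod f R) e1 x u) z =
  act (tensor_mod f R) e4 x (tensor_rmul e3 u z).
Proof.
rewrite /tensor_rmul /=; elim/tensor_ind: u => [|u v hu hv|p q h y w].
- by rewrite !linear0.
- by rewrite !linearD /= hu hv.
have h2 : a + p + q = ab by lia.
have h3 : p + (q + c) = bc by lia.
have h4 : a + p + (q + c) = abc by lia.
rewrite (tensor_act_pure _ _ _ h erefl h2) (tensor_ract_pure _ _ h2 erefl h4).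
by rewrite (tensor_ract_pure _ _ h erefl h3) (tensor_act_pure _ _ _ h3 erefl h4).
Qed.

Lemma tensor_rmul_leibniz (i j l i' j' l' : int) (e : i + j = l) (di : i = i' + 1)
    (dj : j = j' + 1) (dl : l = l' + 1) (el : i' + j = l') (er : i + j' = l')
    u b :
  diff (tensor_mod f R) dl (tensor_rmul e u b) =
    tensor_rmul el (diff (tensor_mod f R) di u) b
    + ksign i *: tensor_rmul er u (diff B dj b).
Proof.
rewrite /tensor_rmul /=; elim/tensor_ind: u => [|u v hu hv|p q h x y].
- by rewrite !linear0 ?scaler0 addr0.
- by rewrite !linearD /= hu hv addrACA.
have q1 : p + (q + j) = l by lia.
have q2 : p - 1 + (q + j) = l' by lia.
have q3 : p - 1 + q = i' by lia.
have q4 : p + (q - 1) = i' by lia.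
have q5 : q + j = q + j' + 1 by lia.
have q6 : p + (q + j') = l' by lia.
have q7 : q - 1 + j = q + j' by lia.
rewrite (tensor_ract_pure _ _ h erefl q1) (tensor_ract_pure _ _ h erefl q6) /=.
rewrite (tensor_diff_pure _ _ _ (deg_pred p) q5 q2 q6).
rewrite (tensor_diff_pure _ _ _ (deg_pred p) (deg_pred q) q3 q4) linearD linearZ /=.
rewrite (tensor_ract_pure _ _ q3 erefl q2) (tensor_ract_pure _ _ q4 q7 q6).
rewrite (ract_leibniz erefl (deg_pred q) dj q5 q7 erefl) linearD linearZ /=.
by rewrite scalerDr scalerA -ksignD h addrA.
Qed.

Definition tensor_bimod : dgbimod Y B :=
  @DGBimod k Y B (tensor_mod f R) tensor_rmul tensor_rmul_linearl
    tensor_rmul_linearr tensor_rmulA tensor_rmul1 tensor_act_rmul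
    tensor_rmul_leibniz.

End TensorBimodule.

Section TensorUnit.
Variables (k : comPzRingType) (A Y : dgalg k) (f : dgalg_hom A Y) (R : dgmod A).

Local Notation T := (tensor_mod f R).

Definition tensor_unit_fun n (y : R n) : T n := tensor_pure f (add0r n) (one Y) y.

Lemma tensor_unit_linear n : linear (@tensor_unit_fun n).
Proof. by move=> c x y; rewrite /tensor_unit_fun linearP. Qed.

Lemma tensor_unit_diff i j (e : i = j + 1) (y : R i) :
  tensor_unit_fun (diff R e y) = diff T e (tensor_unit_fun y).
Proof.
have q1 : -1 + i = j by lia.
have d : 0 = -1 + 1 :> int by [].
rewrite /= /tensor_unit_fun (tensor_diff_pure _ _ _ d e q1 (add0r j)).
rewrite (one_cycle Y d) ksign0 scale1r -[LHS]add0r; congr (_ + _).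
by have := pureZl f q1 0 0 y; rewrite !scale0r.
Qed.

Lemma tensor_unit_act i j l (e : i + j = l) (a : A i) (y : R j) :
  tensor_unit_fun (act R e a y) = act (res_mod f T) e a (tensor_unit_fun y).
Proof.
rewrite /= /res_act /= (tensor_act_pure _ _ _ (add0r j) (addr0 i) e) mulx1.
by rewrite /tensor_unit_fun -(pure_act f (add0r i) e e (add0r l)) mul1x.
Qed.

Definition tensor_unit : dgmod_hom R (res_mod f T) :=
  @DGModHom k A R (res_mod f T)
    (@ChainMap k R (res_mod f T) tensor_unit_fun tensor_unit_linear
      tensor_unit_diff) tensor_unit_act.

End TensorUnit.

Section TensorExtension.
Variables (k : comPzRingType) (A Y : dgalg k) (f : dgalg_hom A Y) (R : dgmod A).
Variable (N : dgmod Y).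

Local Notation T := (tensor_mod f R).
Local Notation pure := (@tensor_pure k A Y f R _ _ _).

Section Extension.
Variables (n : int) (g : ghom R (res_mod f N) n).

Lemma extension_deg p q i j : p + q = i -> i + n = j -> p + (q + n) = j.
Proof. by move=> <- <-; rewrite addrA. Qed.

(** The [Y]-linear extension [x (x) y |-> x g(y)] of [g], with the Koszul sign of
    the exchange of [g] and [x]. *)
Definition extension_fun i j (e : i + n = j) p q (h : p + q = i) (x : Y p)
    (y : R q) : N j :=
  ksign (n * p) *: act N (extension_deg h e) x (gfun g erefl y).

Lemma extension_funE (i j p q r : int) (e : i + n = j) (h : p + q = i)
    (h1 : q + n = r) (h2 : p + r = j) x y :
  extension_fun e h x y = ksign (n * p) *: act N h2 x (gfun g h1 y).
Proof.
by subst r; rewrite /extension_fun (eq_irrelevance (extension_deg h e) h2).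
Qed.

Section Balanced.
Variables (i j : int) (e : i + n = j).

Lemma extension_linearl p q (h : p + q = i) y :
  linear (fun x => extension_fun e h x y).
Proof.
move=> c x x'; rewrite /extension_fun act_linearl scalerDr !scalerA.
by rewrite [c * _]mulrC.
Qed.

Lemma extension_linearr p q (h : p + q = i) x :
  linear (fun y => extension_fun e h x y).
Proof.
by move=> c y y'; rewrite /extension_fun !linearP.
Qed.

Lemma extension_bal (a b c ab bc : int) (e1 : a + b = ab) (e2 : ab + c = i)
    (e3 : b + c = bc) (e4 : a + bc = i) (x : Y a) (z : A b) (y : R c) :
  extension_fun e e2 (mul Y e1 x (f b z)) y =
  extension_fun e e4 x (act R e3 z y).
Proof.
have q : b + (c + n) = bc + n by lia.
rewrite /extension_fun (gfun_act g e3 erefl erefl q) /= /res_act.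
rewrite (actA e1 _ q (extension_deg e4 e)) [act N _ x (_ *: _)]linearZ /= scalerA.
by rewrite -ksignD -mulrDr e1.
Qed.

Definition extension_balanced : balanced f R i (N j) :=
  Balanced extension_linearl extension_linearr extension_bal.

End Balanced.

Definition extension_val i j (e : i + n = j) (u : T i) : N j :=
  tensor_lift (extension_balanced e) u.

Lemma extension_val_linear i j (e : i + n = j) : linear (extension_val e).
Proof. exact: tensor_lift_linear. Qed.

Lemma extension_val_pure (i j p q r : int) (e : i + n = j) (h : p + q = i)
    (h1 : q + n = r) (h2 : p + r = j) x y :
  extension_val e (pure h x y) = ksign (n * p) *: act N h2 x (gfun g h1 y).
Proof. by rewrite /extension_val tensor_lift_pure /= (extension_funE e h h1 h2). Qed.

HB.instance Definition _ i j (e : i + n = j) :=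
  GRing.isLinear.Build k (T i) (N j) *:%R (extension_val e)
    (extension_val_linear e).

Lemma extension_val_act (m i i' j j' : int) (e : m + i = i') (p : i + n = j)
    (p' : i' + n = j') (e' : m + j = j') (a : Y m) (u : T i) :
  extension_val p' (act T e a u) =
    ksign (n * m) *: act N e' a (extension_val p u).
Proof.
elim/tensor_ind: u => [|u v hu hv|r s h x y].
- by rewrite !linear0 ?scaler0.
- by rewrite !linearD /= hu hv.
have q1 : m + r + s = i' by lia.
have q2 : m + r + (s + n) = j' by lia.
have q3 : r + (s + n) = j by lia.
rewrite /= (tensor_act_pure _ _ _ h erefl q1).
rewrite (extension_val_pure _ q1 erefl q2) (extension_val_pure _ h erefl q3).
rewrite [act N e' a (_ *: _)]linearZ /= (actA erefl q2 q3 e') scalerA.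
by rewrite -ksignD mulrDr.
Qed.

Definition extension : ghom T N n :=
  GHom extension_val_linear extension_val_act.

End Extension.

Lemma hom_diff_extension n m (e : n = m + 1) (g : ghom R (res_mod f N) n) :
  hom_diff e (extension g) = extension (hom_diff e g).
Proof.
apply: ghom_ext => i j p u.
elim/tensor_ind: u => [|u v hu hv|r s h x y].
- by rewrite [LHS](linear0 (gfun (hom_diff e (extension g)) p)) linear0.
- rewrite [LHS](linearD (gfun (hom_diff e (extension g)) p)).
  rewrite [RHS](linearD (gfun (extension (hom_diff e g)) p)).
  by rewrite [X in X + _]hu [X in _ + X]hv.
have q1 : i + n = j + 1 by lia.
have q2 : i - 1 + n = j by lia.
have q3 : r - 1 + s = i - 1 by lia.
have q4 : r + (s - 1) = i - 1 by lia.
have q5 : s + m + 1 = s + n by lia.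
have q6 : s - 1 + n = s + m by lia.
have q7 : r + (s + n) = j + 1 by lia.
have q8 : r - 1 + (s + n) = j by lia.
have q9 : r + (s + m) = j by lia.
rewrite [LHS](hom_diff_funE e (extension g) p erefl (deg_pred i) q1 q2) /=.
rewrite (tensor_diff_pure _ _ h (deg_pred r) (deg_pred s) q3 q4).
rewrite [extension_val g q2 (_ + _)]linearD /=.
rewrite [extension_val g q2 (_ *: _)]linearZ /=.
rewrite (extension_val_pure _ _ h erefl q7).
rewrite (extension_val_pure _ _ q3 erefl q8) (extension_val_pure _ _ q4 q6 q9).
rewrite (extension_val_pure _ _ h erefl q9) /=.
rewrite (hom_diff_funE e g erefl (esym q5) (deg_pred s) erefl q6) linearZ /=.
rewrite (act_leibniz q7 (deg_pred r) (esym q5) erefl q8 q9).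
rewrite [act N q9 x (_ - _)]linearB /= [act N q9 x (_ *: _)]linearZ /=.
rewrite !scalerDr !scalerN !scalerA -!ksignD.
have -> : ksign (n + n * (r - 1)) = ksign (n * r) :> k.
  by apply: (@ksign_parity _ _ _ 0); lia.
have -> : ksign (n * r + r) = ksign (m * r) :> k.
  by apply: (@ksign_parity _ _ _ r); rewrite e; lia.
have -> : ksign (n + r + n * r) = ksign (m * r + n) :> k.
  by apply: (@ksign_parity _ _ _ r); rewrite e; lia.
by rewrite opprD addrACA subrr add0r.
Qed.

Lemma extension_cycle n (g : ghom R (res_mod f N) n) :
  is_cycle (g : hom_complex R (res_mod f N) n) ->
  is_cycle (extension g : hom_complex T N n).
Proof.
move=> cg m e; rewrite [LHS]hom_diff_extension.
have -> : hom_diff e g = 0 := cg m e.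
apply: ghom_ext => i j p u /=.
elim/tensor_ind: u => [|u v hu hv|r s h x y].
- by rewrite linear0.
- by rewrite linearD /= hu hv addr0.
have q : r + (s + m) = j by lia.
by rewrite (extension_val_pure _ _ h erefl q) /= linear0 scaler0.
Qed.

End TensorExtension.

(** * Extension of scalars of a module that local modules see as free *)

Section RestrictedComposite.
Variables (k : comPzRingType) (A Y : dgalg k) (f : dgalg_hom A Y).
Variables (R : dgmod A) (M N : dgmod Y).
Variables (g : dgmod_hom M N) (h : dgmod_hom R (res_mod f M)).

Lemma res_comp_act i j l (e : i + j = l) (a : A i) (x : R j) :
  chain_comp (g : chain_map (res_mod f M) (res_mod f N)) h l (act R e a x) =
  act (res_mod f N) e a (chain_comp (g : chain_map (res_mod f M) (res_mod f N)) h j x).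
Proof. by rewrite /= dgmod_hom_act /= /res_act dgmod_hom_act. Qed.

Definition res_comp : dgmod_hom R (res_mod f N) :=
  @DGModHom k A R (res_mod f N)
    (chain_comp (g : chain_map (res_mod f M) (res_mod f N)) h) res_comp_act.

End RestrictedComposite.

(** The evaluation hypotheses say that maps from [R] to [Y] and to [Y (x)_A R]
    are determined by their values at [rho].  The first yields a map
    [phi : R -> Y] with [phi rho ~ 1]; its extension to [Y (x)_A R] is a
    homotopy inverse of [y |-> y (x) rho], because the second shows that
    [r |-> phi r (x) rho] is homotopic to [r |-> 1 (x) r]. *)
Lemma tensor_free_quasi_iso (k : comPzRingType) (A Y : dgalg k)
    (f : dgalg_hom A Y) (R : dgmod A) (rho : R 0) (crho : is_cycle rho)
    (cm : is_cycle (tensor_unit f R 0 rho : tensor_mod f R 0)) :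
  let T := tensor_mod f R in
  quasi_iso (evaluation (res_mod f (regular Y)) crho) ->
  quasi_iso (evaluation (res_mod f T) crho) ->
  quasi_iso (left_mul cm).
Proof.
move=> T /quasi_isoP[_ evS] /quasi_isoP[evI _].
set J := left_mul _.
(* [phi rho] is [1] up to the boundary of [c]. *)
have [phi cphi [c hc]] := evS 0 (one Y) (@one_cycle _ Y).
have {}hc : one Y - gfun phi (add0r 0) rho = diff Y erefl c by rewrite hc.
have cphi' := extension_cycle cphi.
have unitE : J 0 (one Y) = tensor_unit f R 0 rho by exact: act1.
have JE n (y : Y n) : J n y = tensor_pure f (addr0 n) y rho.
  rewrite /J [LHS]/= /tensor_unit_fun.
  by rewrite (tensor_act_pure _ _ _ (add0r 0) (addr0 n) (addr0 n)) mulx1.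
have phiJ n (y : Y n) : is_cycle y ->
    is_boundary (y - hom_of_ghom cphi' n (J n y)).
  move=> cy; rewrite JE.
  rewrite [hom_of_ghom _ _ _](extension_val_pure _ _ (addr0 n) (add0r 0) (addr0 n)).
  rewrite mul0r ksign0 scale1r -[X in X - _](mulx1 (addr0 n) y).
  rewrite -[act _ _ _ _]/(mul Y (addr0 n) y _) -linearB hc /=.
  have q1 : n + (0 + 1) = n + 1 by [].
  have q2 : n - 1 + (0 + 1) = n by rewrite add0r subrK.
  rewrite -[mul _ _ _ _]scale1r -(ksignK k n) -scalerA; apply: boundaryZ.
  have := mul_leibniz q1 (deg_pred n) erefl erefl q2 (addr0 n) y c.
  have mc0 : mul Y q2 0 c = 0 by exact: (act0l (N := regular Y)).
  by rewrite (cy _ (deg_pred n)) mc0 [X in _ = X]add0r => <-; apply: diff_boundary.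
apply/quasi_isoP; split=> n y cy.
  move=> bJ; apply: boundary_homologous (phiJ _ _ cy) _.
  exact: chain_map_boundary.
(* [psi y = 1 (x) y - phi y (x) rho] vanishes at [rho] up to a boundary, hence
   is the differential of some [H]. *)
pose psi : hom_complex R (res_mod f T) 0 :=
  (ghom_of (tensor_unit f R) : hom_complex R (res_mod f T) 0)
  - ghom_of (res_comp J (hom_of_ghom cphi)).
have psi_val n' (e : n' + 0 = n') z :
    gfun psi e z = tensor_unit f R n' z - J n' (hom_of_ghom cphi n' z).
  have -> : gfun psi e z = ghom_of_fun (tensor_unit f R) e z
      - ghom_of_fun (res_comp J (hom_of_ghom cphi)) e z by [].
  by rewrite !ghom_of_funE.
have cpsi : is_cycle psi by apply: cycleB; apply: ghom_of_cycle.
have [H hH] : is_boundary psi.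
  apply: evI => //; rewrite [evaluation _ _ _ _]psi_val -unitE -linearB.
  rewrite [hom_of_ghom _ _ _](_ : _ = gfun phi (add0r 0) rho) ?hc.
    by apply: chain_map_boundary; apply: diff_boundary.
  by rewrite /= (eq_irrelevance (addr0 0) (add0r 0)).
exists (hom_of_ghom cphi' n y); first exact: chain_map_cycle.
have psiE u : u - J n (hom_of_ghom cphi' n u) = gfun (extension psi) (addr0 n) u.
  elim/tensor_ind: u => [|u v hu hv|r s h x z].
  - by rewrite !linear0 addr0.
  - by rewrite !linearD /= addrACA hu hv.
  rewrite [RHS](extension_val_pure _ _ h (addr0 s) h) mul0r ksign0 scale1r.
  rewrite psi_val linearB; congr (_ - _).
    rewrite /= /tensor_unit_fun.
    by rewrite (tensor_act_pure _ _ _ (add0r s) (addr0 r) h) mulx1.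
  rewrite /= -[RHS](dgmod_hom_act J) /=; congr (J n _).
  by rewrite (extension_val_pure _ _ h (addr0 s) h) mul0r ksign0 scale1r.
rewrite psiE -hH -[diff _ _ _]/(hom_diff _ _) -hom_diff_extension.
have q1 : n + (0 + 1) = n + 1 by [].
have q2 : n - 1 + (0 + 1) = n by rewrite add0r subrK.
rewrite [gfun _ _ _]
  (hom_diff_funE erefl (extension H) (addr0 n) erefl (deg_pred n) q1 q2).
by rewrite cy linear0 scaler0 subr0; apply: diff_boundary.
Qed.

(** * Functoriality of the extension of scalars *)

Section TensorMap.
Variables (k : comPzRingType) (A B Y Y' : dgalg k).
Variables (f : dgalg_hom A Y) (f' : dgalg_hom A Y') (g : dgalg_hom Y Y').
Hypothesis gf : forall n x, g n (f n x) = f' n x.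
Variable R : dgbimod A B.

Section Value.
Variable n : int.

Definition tensor_map_fun i j (e : i + j = n) (x : Y i) (y : R j) : tensor f' R n :=
  tensor_pure f' e (g i x) y.

Lemma tensor_map_linearl i j (e : i + j = n) y :
  linear (fun x => tensor_map_fun e x y).
Proof. by move=> c x x'; rewrite /tensor_map_fun linearP pureDl pureZl. Qed.

Lemma tensor_map_linearr i j (e : i + j = n) x :
  linear (fun y => tensor_map_fun e x y).
Proof. by move=> c y y'; rewrite /tensor_map_fun linearP. Qed.

Lemma tensor_map_bal (a b c ab bc : int) (e1 : a + b = ab) (e2 : ab + c = n)
    (e3 : b + c = bc) (e4 : a + bc = n) (x : Y a) (z : A b) (y : R c) :
  tensor_map_fun e2 (mul Y e1 x (f b z)) y = tensor_map_fun e4 x (act R e3 z y).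
Proof.
by rewrite /tensor_map_fun dgalg_hom_mul gf (pure_act f' e1 e2 e3 e4).
Qed.

Definition tensor_map_balanced : balanced f R n (tensor f' R n) :=
  Balanced tensor_map_linearl tensor_map_linearr tensor_map_bal.

Definition tensor_map_val (u : tensor_mod f R n) : tensor_mod f' R n :=
  tensor_lift tensor_map_balanced u.

Lemma tensor_map_val_linear : linear tensor_map_val.
Proof. exact: tensor_lift_linear. Qed.

HB.instance Definition _ :=
  GRing.isLinear.Build k (tensor f R n) (tensor f' R n) *:%R tensor_map_val
    tensor_map_val_linear.

Lemma tensor_map_pure i j (e : i + j = n) x y :
  tensor_map_val (tensor_pure f e x y) = tensor_pure f' e (g i x) y.
Proof. exact: tensor_lift_pure. Qed.

End Value.

Lemma tensor_map_diff i j (e : i = j + 1) (u : tensor_mod f R i) :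
  tensor_map_val (diff (tensor_mod f R) e u) =
  diff (tensor_mod f' R) e (tensor_map_val u).
Proof.
rewrite /=; elim/tensor_ind: u => [|u v hu hv|r s h x y].
- by rewrite !linear0.
- by rewrite !linearD /= hu hv.
have q3 : r - 1 + s = j by lia.
have q4 : r + (s - 1) = j by lia.
rewrite tensor_map_pure (tensor_diff_pure _ _ _ (deg_pred r) (deg_pred s) q3 q4).
rewrite (tensor_diff_pure _ _ _ (deg_pred r) (deg_pred s) q3 q4).
by rewrite linearD linearZ /= !tensor_map_pure cmap_diff.
Qed.

Definition tensor_map : chain_map (tensor_mod f R) (tensor_mod f' R) :=
  ChainMap tensor_map_val_linear tensor_map_diff.

Lemma tensor_map_act i j l (e : i + j = l) (a : Y i) (u : tensor_mod f R j) :
  tensor_map l (act (tensor_mod f R) e a u) =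
  act (tensor_mod f' R) e (g i a) (tensor_map j u).
Proof.
rewrite /=; elim/tensor_ind: u => [|u v hu hv|r s h x y].
- by rewrite !linear0.
- by rewrite !linearD /= hu hv.
have h2 : i + r + s = l by lia.
rewrite tensor_map_pure (tensor_act_pure _ _ _ h erefl h2).
by rewrite (tensor_act_pure _ _ _ h erefl h2) tensor_map_pure dgalg_hom_mul.
Qed.

Lemma tensor_map_ract i j l (e : i + j = l) (u : tensor_mod f R i) (b : B j) :
  tensor_map l (ract (tensor_bimod f R) e u b) =
  ract (tensor_bimod f' R) e (tensor_map i u) b.
Proof.
rewrite /= /tensor_rmul; elim/tensor_ind: u => [|u v hu hv|r s h x y].
- by rewrite !linear0.
- by rewrite !linearD /= hu hv.
have h2 : r + (s + j) = l by lia.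
rewrite tensor_map_pure (tensor_ract_pure _ _ _ h erefl h2).
by rewrite (tensor_ract_pure _ _ _ h erefl h2) tensor_map_pure.
Qed.

Lemma tensor_map_unit n (y : R n) :
  tensor_map n (tensor_unit f R n y) = tensor_unit f' R n y.
Proof. by rewrite /= [LHS]tensor_map_pure dgalg_hom_one. Qed.

End TensorMap.

Lemma tensor_unit_ract (k : comPzRingType) (A B Y : dgalg k)
    (f : dgalg_hom A Y) (R : dgbimod A B) i j l (e : i + j = l) (y : R i) (b : B j) :
  tensor_unit f R l (ract R e y b) =
  ract (tensor_bimod f R) e (tensor_unit f R i y) b.
Proof.
by rewrite /= /tensor_rmul [RHS](tensor_ract_pure _ _ _ (add0r i) e (add0r l)).
Qed.

(** * Local modules and inverting algebras *)

Section ClassesActingOnHomology.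
Variables (k : comPzRingType) (A : dgalg k).

Section ProductsOfCycles.
Variable M : dgmod A.

Lemma cycle_act i j l (e : i + j = l) (a : A i) (x : M j) :
  is_cycle a -> is_cycle x -> is_cycle (act M e a x).
Proof. by move=> ca cx; apply: (act_cycle e (mk_cycle ca) (mk_cycle cx)). Qed.

Lemma boundary_actl i j l (e : i + j = l) (a : A i) (x : M j) :
  is_boundary a -> is_cycle x -> is_boundary (act M e a x).
Proof.
move=> [b <-] cx; have q : i + 1 + j = l + 1 by lia.
by rewrite -(act_diffl q _ erefl erefl e cx); apply: diff_boundary.
Qed.

Lemma boundary_actr i j l (e : i + j = l) (a : A i) (x : M j) :
  is_cycle a -> is_boundary x -> is_boundary (act M e a x).
Proof.
move=> ca [y <-]; have q1 : i + (j + 1) = l + 1 by lia.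
have q2 : i - 1 + (j + 1) = l by lia.
have := act_leibniz q1 (deg_pred i) erefl erefl q2 e a y.
rewrite (ca _ (deg_pred i)) act0l add0r => h.
rewrite -[act _ _ _ _]scale1r -(ksignK k i) -scalerA; apply: boundaryZ.
by rewrite -h; apply: diff_boundary.
Qed.

Lemma actBl i j l (e : i + j = l) (a b : A i) (x : M j) :
  act M e (a - b) x = act M e a x - act M e b x.
Proof. by rewrite addrC -scaleN1r act_linearl scaleN1r addrC. Qed.

Lemma hact_bijectiveP n i j (e : n + i = j) (z : cycles A n) :
  bijective (@hact k A M n i j e (hclass z)) <->
  (forall w : M i, is_cycle w -> is_boundary (act M e (val z) w) ->
     is_boundary w) /\
  (forall v : M j, is_cycle v ->
     exists2 w : M i, is_cycle w & is_boundary (v - act M e (val z) w)).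
Proof.
split=> [bij | [zI zS]].
  split=> [w cw bw | v cv].
    have : hclass (mk_cycle cw) = hclass (mk_cycle (@cycle0 _ M i)).
      apply: (bij_inj bij); rewrite !hactE; apply/hclass_eq => /=.
      by rewrite linear0 subr0.
    by move/hclass_eq; rewrite /= subr0.
  have [g _ gK] := bij; have := gK (hclass (mk_cycle cv)).
  rewrite -{1}(hclass_repr (g _)) hactE => /hclass_eq /= h.
  exists (val (repr (g (hclass (mk_cycle cv))))); first exact: cyclesP.
  exact: boundary_sym.
apply: injective_surjective_bijective => [x y | y].
  rewrite -(hclass_repr x) -(hclass_repr y) !hactE.
  move: (repr x) (repr y) => u v /hclass_eq /= h; apply/hclass_eq.
  apply: zI; first by apply: cycleB; apply: cyclesP.
  by rewrite linearB.
rewrite -(hclass_repr y); move: (repr y) => v.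
have [w cw hw] := zS _ (cyclesP v).
exists (hclass (mk_cycle cw)); rewrite hactE; apply/hclass_eq => /=.
exact: boundary_sym.
Qed.

End ProductsOfCycles.

Lemma S_local_quasi_iso (S : homology_classes A) (M N : dgmod A)
    (r : dgmod_hom M N) : quasi_iso r -> S_local S N -> S_local S M.
Proof.
move=> /quasi_isoP[rI rS] locN n s Ss i j e.
have := locN n s Ss i j e; rewrite -(hclass_repr s); move: (repr s) => z.
move=> /hact_bijectiveP[zI zS]; apply/hact_bijectiveP; split=> [w cw bw | v cv].
  apply: rI => //; apply: zI; first exact: chain_map_cycle.
  by rewrite -dgmod_hom_act; apply: chain_map_boundary.
have [w' cw' hw'] := zS _ (chain_map_cycle r cv).
have [w cw hw] := rS _ _ cw'; exists w => //.
apply: rI; first by apply: cycleB => //; apply: cycle_act => //; apply: cyclesP.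
rewrite linearB /= dgmod_hom_act; apply: boundary_trans hw' _.
by rewrite -linearB; apply: boundary_actr => //; apply: cyclesP.
Qed.

End ClassesActingOnHomology.

Section InvertingClasses.
Variables (k : comPzRingType) (Q : dgalg k) (S : homology_classes Q).

Lemma unit_classP (Y : under Q) n (z : cycles Q n) :
  (exists t : homology Y (- n),
    hmul (subrr n) (hmap (under_str Y) (hclass z)) t = hone Y /\
    hmul (addNr n) t (hmap (under_str Y) (hclass z)) = hone Y) <->
  (exists t : Y (- n), [/\ is_cycle t,
    is_boundary (mul Y (subrr n) (under_str Y n (val z)) t - one Y) &
    is_boundary (mul Y (addNr n) t (under_str Y n (val z)) - one Y)]).
Proof.
split=> [[t] | [t [ct h1 h2]]].
  rewrite -(hclass_repr t) hmapE /hmul !hactE => -[/hclass_eq h1 /hclass_eq h2].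
  by exists (val (repr t)); split => //; apply: cyclesP.
exists (hclass (mk_cycle ct)).
by rewrite hmapE /hmul !hactE; split; apply/hclass_eq.
Qed.

Lemma mulBl (Y : dgalg k) i j l (e : i + j = l) (a b : Y i) (x : Y j) :
  mul Y e (a - b) x = mul Y e a x - mul Y e b x.
Proof. exact: (actBl (M := regular Y)). Qed.

Lemma cycle_mul (Y : dgalg k) i j l (e : i + j = l) (a : Y i) (x : Y j) :
  is_cycle a -> is_cycle x -> is_cycle (mul Y e a x).
Proof. exact: (cycle_act (M := regular Y)). Qed.

Lemma boundary_mull (Y : dgalg k) i j l (e : i + j = l) (a : Y i) (x : Y j) :
  is_boundary a -> is_cycle x -> is_boundary (mul Y e a x).
Proof. exact: (boundary_actl (M := regular Y)). Qed.

Lemma boundary_mulr (Y : dgalg k) i j l (e : i + j = l) (a : Y i) (x : Y j) :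
  is_cycle a -> is_boundary x -> is_boundary (mul Y e a x).
Proof. exact: (boundary_actr (M := regular Y)). Qed.

(** A two-sided inverse of the class of [s] in the homology of [Y] acts as the
    inverse of [s] on every [Y]-module. *)
Lemma S_inverting_local (Y : under Q) (N : dgmod Y) :
  S_inverting S Y -> S_local S (res_mod (under_str Y) N).
Proof.
move=> invY n s Ss i j e; have := invY n s Ss.
rewrite -(hclass_repr s) unit_classP; move: (repr s) => z [t [ct h1 h2]].
have cz : is_cycle (under_str Y n (val z)) by apply/chain_map_cycle/cyclesP.
apply/hact_bijectiveP; split=> [w cw bw | v cv].
  have q : - n + j = i by lia.
  have h : is_boundary (act N (add0r i) (mul Y (addNr n) t (under_str Y n (val z))) w).
    by rewrite (actA _ _ e q); apply: boundary_actr.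
  rewrite -(act1 (d := N) (add0r i) w); apply: boundary_homologous h.
  by rewrite -actBl; apply: boundary_actl => //; apply: boundary_sym.
have q : - n + j = i by lia.
exists (act N q t v); first exact: (cycle_act (M := N)).
rewrite /= /res_act -(actA (subrr n) (add0r j)) -{1}(act1 (d := N) (add0r j) v).
by rewrite -actBl; apply: boundary_actl => //; apply: boundary_sym.
Qed.

(** Surjectivity of the action of [s] gives a right inverse [t].  As [s] kills
    [t s - 1], injectivity shows that [t] is also a left inverse. *)
Lemma S_local_inverting (X : under Q) :
  S_local S (restriction (under_str X)) -> S_inverting S X.
Proof.
move=> locX n s Ss.
have := locX n s Ss _ _ (subrr n); have := locX n s Ss _ _ (addr0 n).
rewrite -(hclass_repr s) unit_classP; move: (repr s) => z.
move=> /hact_bijectiveP[zI _] /hact_bijectiveP[_ zS].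
have cz : is_cycle (under_str X n (val z)) by apply/chain_map_cycle/cyclesP.
have [t ct ht] := zS _ (@one_cycle _ X).
have {}ht : is_boundary (mul X (subrr n) (under_str X n (val z)) t - one X).
  exact: boundary_sym ht.
exists t; split => //; apply: zI.
  by apply: cycleB; [apply: cycle_mul | apply: one_cycle].
rewrite -[act _ _ _ _]/(mul X (addr0 n) (under_str X n (val z)) _) linearB /=.
rewrite mulx1 -(mulA (subrr n) (add0r n)) -[X in _ - X](mul1x (add0r n)).
by rewrite -mulBl; apply: boundary_mull.
Qed.

Lemma S_inverting_map (Y Z : under Q) (g : under_hom Y Z) :
  S_inverting S Y -> S_inverting S Z.
Proof.
move=> invY n s Ss; have := invY n s Ss.
rewrite -(hclass_repr s) !unit_classP => -[t [ct h1 h2]].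
exists (g _ t); rewrite -!(under_hom_str g); split; first exact: chain_map_cycle.
  by rewrite -dgalg_hom_mul -(dgalg_hom_one g) -linearB; apply: chain_map_boundary.
by rewrite -dgalg_hom_mul -(dgalg_hom_one g) -linearB; apply: chain_map_boundary.
Qed.

Lemma S_inverting_quasi_iso (Y Z : under Q) (g : under_hom Y Z) :
  quasi_iso g -> S_inverting S Z -> S_inverting S Y.
Proof.
move=> /quasi_isoP[gI gS] invZ n s Ss; have := invZ n s Ss.
rewrite -(hclass_repr s) !unit_classP => -[t' [ct' h1 h2]].
have [t ct ht] := gS _ _ ct'.
have cz : is_cycle (under_str Y n (val (repr s))) by apply/chain_map_cycle/cyclesP.
have cz' : is_cycle (under_str Z n (val (repr s))) by apply/chain_map_cycle/cyclesP.
have c1 := @one_cycle _ Y.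
exists t; split=> //; (apply: gI; first by apply: cycleB => //; apply: cycle_mul);
  rewrite linearB /= dgalg_hom_mul dgalg_hom_one under_hom_str.
  apply: boundary_trans h1; rewrite -linearB; apply: boundary_mulr => //.
  exact: boundary_sym.
apply: boundary_trans h2; rewrite -mulBl; apply: boundary_mull => //.
exact: boundary_sym.
Qed.

End InvertingClasses.

(** * Natural families of morphisms in the homotopy category *)

Section DGAlgebraMaps.
Variables (k : comPzRingType).

Definition dgalg_comp (A B C : dgalg k) (g : dgalg_hom B C) (f : dgalg_hom A B) :
  dgalg_hom A C.
Proof.
refine (@DGAlgHom k A C (chain_comp g f) _ _).
- by move=> i j l e x y; rewrite /= !dgalg_hom_mul.
- by rewrite /= !dgalg_hom_one.
Defined.

Definition dgalg_id (A : dgalg k) : dgalg_hom A A.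
Proof.
unshelve refine (@DGAlgHom k A A (@ChainMap k A A (fun n x => x) _ _) _ _); by [].
Defined.

Lemma under_hom_ext (Q : dgalg k) (X Y : under Q) (f g : under_hom X Y) :
  (forall n x, f n x = g n x) -> f = g.
Proof.
case: f g => [[[f fl fd] fm fo] fs] [[[g gl gd] gm go] gs] /= fg.
have E : f = g.
  by apply: functional_extensionality_dep => n; apply/funext => x; apply: fg.
subst g.
have E : ChainMap fl fd = ChainMap gl gd by congr ChainMap; apply: Prop_irrelevance.
move: gm go gs fm fo fs; rewrite -E => gm go gs fm fo fs.
have E' : DGAlgHom fm fo = DGAlgHom gm go by congr DGAlgHom; apply: Prop_irrelevance.
by move: gs fs; rewrite -E' => gs fs; congr UnderHom; apply: Prop_irrelevance.
Qed.

End DGAlgebraMaps.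

Section HomotopyCategory.
Variables (k : comPzRingType) (Q : dgalg k).
Implicit Types X Y Z W : under Q.

Lemma ho_cancel_inv X Y Z (w : under_hom X Y) (hw : quasi_iso w) (g : ho_hom X Z) :
  ho_eq (ho_comp (ho_comp g (ho_inv hw)) (ho_map w)) g.
Proof.
apply: ho_trans (ho_sym (ho_compA _ _ _)) _.
apply: ho_trans (ho_comp1r g); apply: ho_comp_congr; first exact: ho_refl.
exact: ho_invl.
Qed.

Lemma ho_inv_cancel X Y Z (w : under_hom X Y) (hw : quasi_iso w) (g : ho_hom Z X) :
  ho_eq (ho_comp (ho_inv hw) (ho_comp (ho_map w) g)) g.
Proof.
apply: ho_trans (ho_compA _ _ _) _.
apply: ho_trans (ho_comp1l g); apply: ho_comp_congr; last exact: ho_refl.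
exact: ho_invl.
Qed.

Section Cone.
Variables (P : under Q -> Prop) (E : under Q) (F : under Q -> under Q).
Variables (src : forall Y, under_hom (F Y) E) (tgt : forall Y, under_hom (F Y) Y).
Variable (F_map : forall Y Z, under_hom Y Z -> under_hom (F Y) (F Z)).
Hypothesis P_map : forall Y Z, under_hom Y Z -> P Y -> P Z.
Hypothesis P_quasi_iso : forall Y Z (w : under_hom Y Z), quasi_iso w -> P Z -> P Y.
Hypothesis src_map : forall Y Z (g : under_hom Y Z),
  under_comp (src Z) (F_map g) = src Y.
Hypothesis tgt_map : forall Y Z (g : under_hom Y Z),
  under_comp (tgt Z) (F_map g) = under_comp g (tgt Y).
Hypothesis src_quasi_iso : forall Y, P Y -> quasi_iso (src Y).

Definition cone_leg Y (hY : P Y) : ho_hom E Y :=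
  ho_comp (ho_map (tgt Y)) (ho_inv (src_quasi_iso hY)).

(** The only point is that [F_map g] commutes with the formal inverses of the
    [src], because it commutes with the [src] themselves. *)
Lemma cone_leg_map Y Z (g : under_hom Y Z) (hY : P Y) (hZ : P Z) :
  ho_eq (ho_comp (ho_map g) (cone_leg hY)) (cone_leg hZ).
Proof.
have e1 : ho_eq (ho_comp (ho_map (F_map g)) (ho_inv (src_quasi_iso hY)))
    (ho_inv (src_quasi_iso hZ)).
  apply: ho_trans (ho_sym (ho_inv_cancel (src_quasi_iso hZ) _)) _.
  apply: ho_trans (ho_comp1r _); apply: ho_comp_congr; first exact: ho_refl.
  apply: ho_trans (ho_compA _ _ _) _.
  apply: ho_trans (ho_invr (src_quasi_iso hY)).
  apply: ho_comp_congr; last exact: ho_refl.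
  by apply: ho_trans (ho_sym (ho_map_comp _ _)) _; rewrite src_map; apply: ho_refl.
apply: ho_trans (ho_compA _ _ _) _.
apply: ho_trans (ho_comp_congr (ho_sym (ho_map_comp g (tgt Y))) (ho_refl _)) _.
rewrite -tgt_map.
apply: ho_trans (ho_comp_congr (ho_map_comp _ _) (ho_refl _)) _.
apply: ho_trans (ho_sym (ho_compA _ _ _)) _.
by apply: ho_comp_congr; first exact: ho_refl.
Qed.

(** For a zigzag, naturality passes through formal inverses because [P] is
    reflected by quasi-isomorphisms. *)
Lemma cone_leg_natural Y Z (g : ho_hom Y Z) (hY : P Y) :
  exists hZ : P Z, ho_eq (ho_comp g (cone_leg hY)) (cone_leg hZ).
Proof.
elim: g hY => [Y' Z' g hY | X' Y' w hw hY | X' Y' Z' g ihg f ihf hX].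
- by exists (P_map g hY); apply: cone_leg_map.
- exists (P_quasi_iso hw hY).
  have e := cone_leg_map w (P_quasi_iso hw hY) hY.
  apply: ho_trans (ho_comp_congr (ho_refl _) (ho_sym e)) _.
  exact: ho_inv_cancel.
have [hY e1] := ihf hX; have [hZ e2] := ihg hY; exists hZ.
apply: ho_trans (ho_sym (ho_compA _ _ _)) _.
by apply: ho_trans (ho_comp_congr (ho_refl g) e1) e2.
Qed.

(** If the leg [c_X] is invertible, naturality [g c_X = c_Y] determines [g]. *)
Lemma cone_leg_initial X (hX : P X) : quasi_iso (tgt X) ->
  forall Y, P Y -> exists f : ho_hom X Y, forall g : ho_hom X Y, ho_eq f g.
Proof.
move=> qX Y hY; pose cinv := ho_comp (ho_map (src X)) (ho_inv qX).
have cK (g : ho_hom X Y) : ho_eq (ho_comp (ho_comp g (cone_leg hX)) cinv) g.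
  apply: ho_trans (ho_sym (ho_compA _ _ _)) _.
  apply: ho_trans (ho_comp1r g); apply: ho_comp_congr; first exact: ho_refl.
  apply: ho_trans (ho_compA _ _ _) _.
  apply: ho_trans (ho_comp_congr (ho_cancel_inv _ _) (ho_refl _)) _.
  exact: ho_invr.
exists (ho_comp (cone_leg hY) cinv) => g.
apply: (ho_trans _ (cK g)); apply: ho_comp_congr; last exact: ho_refl.
have [hY' e] := cone_leg_natural g hX.
by apply: ho_sym; rewrite (Prop_irrelevance hY hY').
Qed.

End Cone.

End HomotopyCategory.

(** * The comparison algebras and initiality *)

Section Initiality.
Variables (k : comPzRingType) (Q : dgalg k).
Hypothesis cQ : cofibrant_dgalg Q.
Variables (R : dgmod Q) (rho : R 0) (crho : is_cycle rho).
Variable S : homology_classes Q.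
Hypothesis ev_quasi_iso : forall N : dgmod Q,
  S_local S N -> quasi_iso (evaluation N crho).
Hypothesis R_local : S_local S R.

Local Notation RE := (end_bimod R).

Let base_tri := tri (M := RE) crho.

Lemma end_free_quasi_iso : quasi_iso (right_mul_map (M := RE) crho).
Proof.
apply: quasi_iso_ext (ev_quasi_iso R_local) => n x.
by rewrite /= /end_act mul0r ksign0 scale1r.
Qed.

(** A section turns every algebra that receives a map from [base_tri] into an
    algebra under [Q], compatibly with the structure map of each [Y]. *)
Lemma section_exists :
  exists s : dgalg_hom Q base_tri, forall n x, (s n x).1.1 = x.
Proof.
have [s hs] := cQ (dgalg_id Q) (@tri_projA_surjective _ _ _ RE _ crho)
  (tri_projA_quasi_iso end_free_quasi_iso).
by exists s.
Qed.

Variables (s : dgalg_hom Q base_tri) (sK : forall n x, (s n x).1.1 = x).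

Definition base_unit (Y : under Q) : tensor_bimod (under_str Y) RE 0 :=
  tensor_unit (under_str Y) R 0 rho.

Lemma base_unit_cycle (Y : under Q) : is_cycle (base_unit Y).
Proof. exact: (chain_map_cycle (tensor_unit (under_str Y) R) crho). Qed.

(** The algebra [T_Y] of homotopies between [y (x) rho] and [1 (x) rho e]. *)
Definition comparison_alg (Y : under Q) : dgalg k := tri (base_unit_cycle Y).

Definition from_base_tri (Y : under Q) : dgalg_hom base_tri (comparison_alg Y) :=
  @tri_map k Q Y (end_alg R) RE (tensor_bimod (under_str Y) RE) (under_str Y)
    (tensor_unit (under_str Y) R) rho (base_unit Y) crho (base_unit_cycle Y)
    (@dgmod_hom_act _ _ _ _ (tensor_unit (under_str Y) R))
    (@tensor_unit_ract _ _ _ _ (under_str Y) RE) erefl.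

Definition comparison (Y : under Q) : under Q :=
  Under (dgalg_comp (from_base_tri Y) s).

Definition end_under : under Q := Under (dgalg_comp (tri_projB (M := RE) crho) s).

Definition comparison_src (Y : under Q) : under_hom (comparison Y) end_under :=
  @UnderHom k Q (comparison Y) end_under (tri_projB (base_unit_cycle Y))
    (fun _ _ => erefl).

Lemma comparison_tgt_str (Y : under Q) n x :
  tri_projA (base_unit_cycle Y) n (under_str (comparison Y) n x) = under_str Y n x.
Proof. by rewrite /= sK. Qed.

Definition comparison_tgt (Y : under Q) : under_hom (comparison Y) Y :=
  @UnderHom k Q (comparison Y) Y (tri_projA (base_unit_cycle Y))
    (comparison_tgt_str Y).

Section Functoriality.
Variables (Y Z : under Q) (g : under_hom Y Z).

Definition comparison_map_alg : dgalg_hom (comparison_alg Y) (comparison_alg Z) :=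
  @tri_map k Y Z (end_alg R) (tensor_bimod (under_str Y) RE)
    (tensor_bimod (under_str Z) RE) g
    (tensor_map (@under_hom_str _ _ _ _ g) RE) (base_unit Y) (base_unit Z)
    (base_unit_cycle Y) (base_unit_cycle Z)
    (@tensor_map_act _ _ _ _ _ _ _ _ (@under_hom_str _ _ _ _ g) RE)
    (@tensor_map_ract _ _ _ _ _ _ _ _ (@under_hom_str _ _ _ _ g) RE)
    (tensor_map_unit (@under_hom_str _ _ _ _ g) (R := RE) _).

Lemma comparison_map_str n x :
  comparison_map_alg n (under_str (comparison Y) n x) =
  under_str (comparison Z) n x.
Proof.
apply: pair_ext; last exact: (tensor_map_unit (@under_hom_str _ _ _ _ g) (R := RE)).
by apply: pair_ext; rewrite //= under_hom_str.
Qed.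

Definition comparison_map : under_hom (comparison Y) (comparison Z) :=
  @UnderHom k Q (comparison Y) (comparison Z) comparison_map_alg comparison_map_str.

End Functoriality.

Lemma comparison_src_quasi_iso (Y : under Q) :
  S_inverting S Y -> quasi_iso (comparison_src Y).
Proof.
move=> invY; apply: tri_projB_quasi_iso.
by apply: tensor_free_quasi_iso; apply: ev_quasi_iso; apply: S_inverting_local.
Qed.

(** The action [mu : X (x)_Q R -> X], [x (x) y |-> x r(y)], is inverse on
    homology to the free map [x |-> x (x) rho], and [mu (1 (x) y) = r y].  Hence
    [R -> X (x)_Q R] is a quasi-isomorphism, and [e |-> 1 (x) rho e] is its
    composite with [E -> R]. *)
Lemma comparison_tgt_quasi_iso (X : under Q)
    (r : dgmod_hom R (res_mod (under_str X) (regular X))) :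
  S_inverting S X -> quasi_iso r -> is_boundary (one X - r 0 rho) ->
  quasi_iso (comparison_tgt X).
Proof.
move=> invX qr hr; apply: tri_projA_quasi_iso.
pose mu := hom_of_ghom (extension_cycle (ghom_of_cycle r)).
pose J := left_mul (base_unit_cycle X).
have qJ : quasi_iso J.
  by apply: tensor_free_quasi_iso; apply: ev_quasi_iso; apply: S_inverting_local.
have qmu : quasi_iso mu.
  apply: (quasi_iso_cancel_right (f := J)) => //.
  apply: (quasi_iso_homologous (f := dgalg_id X)); last exact: quasi_iso_id.
  move=> n x cx /=; rewrite /tensor_unit_fun.
  rewrite (tensor_act_pure _ _ _ (add0r 0) (addr0 n) (addr0 n)) mulx1.
  rewrite (extension_val_pure _ _ (addr0 n) (addr0 0) (addr0 n)) mul0r ksign0 scale1r.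
  rewrite [gfun _ _ _](ghom_of_funE r) -{1}(mulx1 (addr0 n) x).
  rewrite -[act _ _ _ _]/(mul X (addr0 n) x _) -linearB.
  exact: boundary_mulr.
have qu : quasi_iso (tensor_unit (under_str X) R).
  apply: (quasi_iso_cancel_left qmu).
  apply: quasi_iso_ext qr => n y /=.
  rewrite (extension_val_pure _ _ (add0r n) (addr0 n) (add0r n)) mul0r ksign0 scale1r.
  by rewrite [gfun _ _ _](ghom_of_funE r) [RHS](mul1x (d := X)).
apply: quasi_iso_ext (quasi_iso_comp qu end_free_quasi_iso) => n b.
exact: (@tensor_unit_ract _ _ _ _ (under_str X) RE).
Qed.

Lemma comparison_initial (X : under Q)
    (r : dgmod_hom R (res_mod (under_str X) (regular X))) :
  S_inverting S X -> quasi_iso r -> is_boundary (one X - r 0 rho) ->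
  forall Y, S_inverting S Y -> exists f : ho_hom X Y, forall g, ho_eq f g.
Proof.
move=> invX qr hr.
apply: (@cone_leg_initial k Q (S_inverting S) end_under comparison comparison_src
  comparison_tgt comparison_map (@S_inverting_map _ _ S) (@S_inverting_quasi_iso _ _ S)
  _ _ comparison_src_quasi_iso X invX (comparison_tgt_quasi_iso invX qr hr)).
- by move=> Y Z g; apply: under_hom_ext.
- by move=> Y Z g; apply: under_hom_ext.
Qed.

End Initiality.

Theorem theorem4p26 (k : comPzRingType) (A Q : dgalg k) (q : dgalg_hom Q A)
    (hq : dgalg_cofibrant_replacement q) (S : homology_classes A)
    (X : under Q) :
  module_localisation (classes_along q S) (structure_map (under_str X)) ->
  dgalg_localisation (classes_along q S) X.
Proof.
case: hq => cQ _ [locX [P [R [p [r [ft [[cP qp] [_ qr] rft qft]]]]]]].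
have invX := S_local_inverting locX; split=> //.
have [rhoP crhoP hrho] : exists2 rhoP : P 0, is_cycle rhoP &
    is_boundary (one Q - (p 0 rhoP : Q 0)).
  by move/quasi_isoP: (qp) => [_ pS]; apply: pS; apply: one_cycle.
pose crho := chain_map_cycle ft crhoP.
have ev_qi N : S_local (classes_along q S) N -> quasi_iso (evaluation N crho).
  move=> locN.
  apply: quasi_iso_ext (quasi_iso_comp
    (evaluation_quasi_iso N crhoP cP qp (boundary_sym hrho)) (qft N locN)) => n g.
  by [].
have locR := S_local_quasi_iso qr locX.
have [s sK] := section_exists cQ ev_qi locR.
pose r' : dgmod_hom R (res_mod (under_str X) (regular X)) :=
  @DGModHom k Q R (res_mod (under_str X) (regular X)) r (@dgmod_hom_act _ _ _ _ r).
apply: (comparison_initial ev_qi locR sK (r := r')) => //=.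
rewrite rft /= -(dgalg_hom_one (under_str X)) -linearB.
exact: chain_map_boundary.
Qed.
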